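(* Let $(T,(D_v)_{v\in T},(X_v)_{v\in T},(\Lambda_v)_{v\in T})$ be a decorated branching random walk with reproduction scheme $(\chi,\Lambda,D,(X_i)_{1\le i\le\chi(\mathbb{R})})$ satisfying Assumptions 1--6 listed in the context. Then, as $r\to\infty$, $$\mathbb{P}\Big(\sup_{v\in T}\Lambda_v>r\Big)\sim\frac{6\eta^2}{\sigma^2r^2}.$$
   Context: Let $\mathcal{U}=\bigcup_{n\ge0}\{1,2,\dots\}^n$ be the set of finite words ($\emptyset$ is the empty word, $|u|$ the length of $u$). A finite point process on $\mathbb{R}$ is a random finite counting measure; for a counting measure $\mu$, $\sup\mu$ is the supremum of its support, with $\sup\mu=-\infty$ if $\mu=0$. A reproduction scheme is $(\chi,\Lambda,D,(X_i)_{1\le i\le\chi(\mathbb{R})})$ where $\chi$ is a finite point process on $\mathbb{R}$, $(X_i)$ is a measurable enumeration of its atoms ($\chi=\sum_i\delta_{X_i}$), $\Lambda\ge0$ is a random variable with $\Lambda\ge\sup\chi$ a.s., and $D\ge0$ is a random variable; the joint law is otherwise arbitrary. The decorated branching random walk with this scheme is built from i.i.d. copies $(\chi_u,\Lambda^{(u)},D_u,(X^{(u)}_i)_{i})_{u\in\mathcal{U}}$ of the scheme: $T\subset\mathcal{U}$ is the random tree with $\emptyset\in T$ and $uj\in T$ iff $u\in T$ and $1\le j\le\chi_u(\mathbb{R})$; $X_\emptyset=0$, $X_{uj}=X_u+X^{(u)}_j$, and $\Lambda_u=X_u+\Lambda^{(u)}$. The mean measure is $M(A)=\mathbb{E}[\chi(A)]$.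 Assumptions: (1) $\mathbb{E}[\chi(\mathbb{R})]=1$; (2) $\mathbb{E}[\int x\,d\chi(x)]=0$; (3) $\mathbb{E}[\chi(\mathbb{R})^2]=\sigma^2+1\in(1,\infty)$; (4) $\mathbb{E}[\int x^2\,d\chi(x)]=\eta^2\in(0,\infty)$; (5) $\mathbb{P}(\Lambda>r)=o(r^{-4})$ as $r\to\infty$; (6) $\mathbb{E}[D]=1$. *)

(* Defs.v *)
(* Library: MathComp / MathComp-Analysis. *)
From HB Require Import structures.
From mathcomp Require Import all_boot all_order all_algebra.
From mathcomp Require Import all_classical all_reals all_analysis.

Set Implicit Arguments.
Unset Strict Implicit.
Unset Printing Implicit Defensive.

Import Order.TTheory GRing.Theory Num.Theory.
Import numFieldNormedType.Exports.

Local Open Scope classical_set_scope.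
Local Open Scope ring_scope.

(* Lets the Landau notations be used with the filter of neighborhoods of +oo. *)
Canonical pinfty_filter_on (R : numFieldType) :=
  @FilterType R (pinfty_nbhs R) _.

(* An enumeration (X_1, ..., X_n) of the atoms of a finite counting measure is
   a finite sequence, 0-indexed, whose length is the total mass.  The
   sigma-algebra on [seq R] below is that of the disjoint union of the R^n,
   n >= 0: [nth 0 s i] is constantly 0 on the pieces with n <= i. *)
HB.instance Definition _ (R : realType) := isPointed.Build (seq R) [::].

Definition atoms_generators (R : realType) : set (set (seq R)) :=
  [set A | (exists n : nat, A = [set s | size s = n])
        \/ (exists (i : nat) (B : set R),
             measurable B /\ A = [set s | B (nth 0 s i)])].

Definition atoms (R : realType) := g_sigma_algebraType (@atoms_generators R).

(* A value ((X_i)_i, Lambda, D) of a reproduction scheme. *)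
Definition scheme (R : realType) := (atoms R * R * R)%type.

Section SchemeValue.
Context {R : realType}.
Implicit Types z : scheme R.

Definition enum_atoms z : seq R := z.1.1.

Definition chi z : {measure set R -> \bar R} :=
  msum (fun i => \d_(nth 0 (enum_atoms z) i)) (size (enum_atoms z)).

Definition Lam z : R := z.1.2.

Definition dec z : R := z.2.

End SchemeValue.

Definition support {R : realType} (mu : {measure set R -> \bar R}) : set R :=
  [set x | forall U : set R, open U -> U x -> (0 < mu U)%E].

Definition sup_measure {R : realType} (mu : {measure set R -> \bar R}) : \bar R :=
  ereal_sup [set x%:E | x in support mu].

Definition reproduction_scheme {R : realType} {d} {W : measurableType d}
    (P : probability W R) (S : {RV P >-> scheme R}) : Prop :=
  [/\ {ae P, forall w, 0 <= Lam (S w)},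
      {ae P, forall w, (sup_measure (chi (S w)) <= (Lam (S w))%:E)%E} &
      {ae P, forall w, 0 <= dec (S w)}].

Definition mutually_independent {R : realType} {d} {W : measurableType d}
    (P : probability W R) {I : eqType} {d'} {V : measurableType d'}
    (S : I -> {RV P >-> V}) : Prop :=
  forall (J : seq I) (A : I -> set V), uniq J ->
    (forall i, measurable (A i)) ->
    P (\big[setI/setT]_(i <- J) (S i @^-1` A i)) =
    (\prod_(i <- J) P (S i @^-1` A i))%E.

Definition iid_copies {R : realType} {I : eqType} {d'} {V : measurableType d'}
    {d0} {W0 : measurableType d0} (P0 : probability W0 R) (S0 : {RV P0 >-> V})
    {d} {W : measurableType d} (P : probability W R)
    (S : I -> {RV P >-> V}) : Prop :=
  mutually_independent S /\
  (forall i (A : set V), measurable A ->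
     distribution P (S i) A = distribution P0 S0 A).

(* Finite words over {1, 2, ...}, with the letter j >= 1 stored as j - 1, so
   that it is also the index of the j-th atom in [enum_atoms]. *)
Definition word := seq nat.

Section Tree.
Context {R : realType}.
Variable s : word -> scheme R.
Implicit Types u : word.

Definition in_tree u : bool :=
  [forall k : 'I_(size u),
     (nth 0 u k < size (enum_atoms (s (take k u))))%N].

Definition pos u : R :=
  \sum_(k < size u) nth 0 (enum_atoms (s (take k u))) (nth 0%N u k).

Definition Lam_at u : R := pos u + Lam (s u).

Definition sup_Lam : \bar R := ereal_sup [set (Lam_at v)%:E | v in [set v | in_tree v]].

Lemma in_tree_nil : in_tree [::].
Proof. by apply/forallP => -[]. Qed.

Lemma in_tree_rcons u j :
  in_tree (rcons u j) = in_tree u && (j < size (enum_atoms (s u)))%N.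
Proof.
apply/forallP/andP => [H|[/forallP H Hj] [k]].
  split; last first.
    have Hk : (size u < size (rcons u j))%N by rewrite size_rcons.
    by have := H (Ordinal Hk); rewrite /= nth_rcons ltnn eqxx -cats1 take_size_cat.
  apply/forallP => -[k Hk] /=.
  have Hk' : (k < size (rcons u j))%N by rewrite size_rcons ltnW.
  by have := H (Ordinal Hk'); rewrite /= nth_rcons Hk -cats1 takel_cat // ltnW.
rewrite /= size_rcons ltnS leq_eqVlt nth_rcons => /predU1P[->|Hk].
  by rewrite ltnn eqxx -cats1 take_size_cat.
by rewrite Hk -cats1 takel_cat ?(ltnW Hk)//; exact: (H (Ordinal Hk)).
Qed.

Lemma pos_nil : pos [::] = 0.
Proof. by rewrite /pos big_ord0. Qed.

Lemma pos_rcons u j : pos (rcons u j) = pos u + nth 0 (enum_atoms (s u)) j.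
Proof.
rewrite /pos size_rcons big_ord_recr /= nth_rcons ltnn eqxx -cats1 take_size_cat//.
congr (_ + _); apply: eq_bigr => -[k Hk] _ /=.
by rewrite nth_cat Hk takel_cat // ltnW.
Qed.

End Tree.

(* Main.v *)
Require Import Defs.
From HB Require Import structures.
From mathcomp Require Import all_boot all_order all_algebra ring lra.
From mathcomp Require Import all_classical all_reals all_analysis.
From mathcomp Require Import measurable_realfun.

Set Implicit Arguments.
Unset Strict Implicit.
Unset Printing Implicit Defensive.

Import Order.TTheory GRing.Theory Num.Theory.
Import numFieldNormedType.Exports.

Local Open Scope classical_set_scope.
Local Open Scope ring_scope.

(** Let [u_n t] be the probability that some individual of the first [n]
    generations has [Lam_at > t]; these probabilities increase to the tail
    [u t].  Conditioning on the root, whose subtrees are independent copies of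
    the whole tree, gives
      [1 - u_(n+1) t = E (1_(Lam <= t) * prod_i (1 - u_n (t - X_i)))],
    which is [law_max_upto] with [stay n = 1 - u_n].  If [u] is small and varies
    slowly, then to second order, and since the mean mass is [1] and the mean
    displacement is [0], the limiting equation reads
      [0 = eta^2 / 2 * u'' - sigma^2 / 2 * u^2],
    and [C / t^2] solves it exactly when [C = 6 * eta^2 / sigma^2].

    The right-hand side of the recursion is monotone in [u_n], so the heuristic
    is turned into a proof by comparison: for [c > C] a shifted [c / y^2] is a
    supersolution far away ([stay_upper_bound]), and for [c < C] it is a
    subsolution ([stay_lower_bound]).  Three points need care.

    - Only second moments of the offspring are finite, hence third order terms
      cannot be expanded.  The quadratic term of the product is used only where
      [extent <= K], which carries almost all of the second factorial moment
      ([truncated_mean_small]); elsewhere the product is bounded linearly.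
    - In the upper bound, the expansion of [c / (y - x)^2] fails for [x > e * y].
      Such a jump forces [Lam > e * y], which has probability [o(y^-4)] and is
      therefore negligible against the gain, of order [y^-4].  In the lower
      bound these atoms are dropped, at the price of a truncated second moment.
    - The comparison needs initial data.  The subsolution starts [1] above
      [u_0 = 0], and criticality makes such an error decay along
      [q_(n+1) = q_n - k * q_n^2] ([stay_contraction]); this is the extinction of
      the critical tree.  The same contraction compares [u_m] with [u_n] and gives
      [u_n t --> 0] uniformly in [n] ([stay_uniform_cvg1]), from which the
      supersolution starts. *)

(** * Products of numbers close to one *)

Section ProductBounds.
Context {R : realType} {T : eqType}.
Implicit Types (xs : seq T) (f g : T -> R).

Let mem_tail x xs y : y \in xs -> y \in x :: xs.
Proof. by rewrite inE => ->; rewrite orbT. Qed.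

Lemma prod_unit_interval xs f : (forall x, x \in xs -> 0 <= f x <= 1) ->
  0 <= \prod_(x <- xs) f x <= 1.
Proof.
move=> f01; apply/andP; split.
  by rewrite big_seq prodr_ge0// => x /f01/andP[].
by rewrite big_seq; apply: prodr_ile1 => x /f01.
Qed.

(** The second Bonferroni inequality, with every product of two factors bounded
    by [b ^+ 2]. *)
Lemma prod_onem_le_pairs xs f (b : R) : b <= 1 ->
  (forall x, x \in xs -> 0 <= f x <= b) ->
  \prod_(x <- xs) (1 - f x) <=
    1 - \sum_(x <- xs) f x + b ^+ 2 / 2 * ((size xs)%:R ^+ 2 - (size xs)%:R).
Proof.
move=> b1; elim: xs => [|x xs IH] fb; first by rewrite !big_nil /=; lra.
have {}IH := IH (fun y yxs => fb y (mem_tail x yxs)).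
have /andP[fx0 fxb] := fb x (mem_head _ _).
have S0 : 0 <= \sum_(y <- xs) f y.
  by rewrite big_seq sumr_ge0// => y yxs; have /andP[] := fb y (mem_tail x yxs).
have Sb : \sum_(y <- xs) f y <= (size xs)%:R * b.
  rewrite -sum1_size natr_sum mulr_suml big_seq [leRHS]big_seq.
  by apply: ler_sum => y yxs; rewrite mul1r; have /andP[] := fb y (mem_tail x yxs).
rewrite !big_cons /= -[(size xs).+1%:R]natr1.
set n := (size xs)%:R in IH Sb *; set S := \sum_(y <- xs) f y in IH S0 Sb *.
have n0 : 0 <= n by rewrite ler0n.
have nn : 0 <= n ^+ 2 - n.
  rewrite /n; case: (size xs) => [|m]; first by rewrite expr0n subr0.
  by rewrite -natr1; have := ler0n R m; nra.
have h1 := ler_wpM2l (_ : 0 <= 1 - f x) IH.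
apply: le_trans (h1 _) _; first by lra.
have h2 : f x * S <= b * (n * b) by apply: ler_pM.
have h3 : 0 <= f x * (b ^+ 2 / 2 * (n ^+ 2 - n)).
  by rewrite mulr_ge0// mulr_ge0// divr_ge0// sqr_ge0.
nra.
Qed.

(** A converse of the second Bonferroni inequality that avoids third order terms:
    when [K * a] is small, so is the loss, a fraction [K * a] of the
    quadratic term.  The entries need not be small, only at least [a]; this is
    what keeps the induction going. *)
Lemma prod_onem_ge_pairs xs f (a K : R) : 0 <= a -> K * a <= 1 ->
  (size xs)%:R <= K -> (forall x, x \in xs -> a <= f x <= 1) ->
  1 - \sum_(x <- xs) f x
    + (1 - K * a) * (a ^+ 2 / 2 * ((size xs)%:R ^+ 2 - (size xs)%:R)) <=
  \prod_(x <- xs) (1 - f x).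
Proof.
move=> a0 Ka; elim: xs => [|x xs IH] szK fa; first by rewrite !big_nil /=; lra.
move: szK; rewrite /= -[(size xs).+1%:R]natr1 => szK.
have {}IH := IH _ (fun y yxs => fa y (mem_tail x yxs)).
have {}IH := IH (le_trans (ler_wpDr ler01 (lexx _)) szK).
have /andP[fxa fx1] := fa x (mem_head _ _).
have Sa : (size xs)%:R * a <= \sum_(y <- xs) f y.
  rewrite -sum1_size natr_sum mulr_suml big_seq [leRHS]big_seq.
  by apply: ler_sum => y yxs; rewrite mul1r; have /andP[] := fa y (mem_tail x yxs).
rewrite !big_cons.
set n := (size xs)%:R in IH Sa szK *; set S := \sum_(y <- xs) f y in IH Sa *.
have n0 : 0 <= n by rewrite ler0n.
apply: le_trans (ler_wpM2l (_ : 0 <= 1 - f x) IH); last by lra.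
set th := 1 - K * a.
have th0 : 0 <= th by rewrite /th; lra.
(* What the new entry [f x >= a] adds to the quadratic term, at least
   [th * a ^+ 2 * n], is paid by the cross term [f x * S >= f x * (n * a)]. *)
have th1 : th * (a * n + a ^+ 2 / 2 * (n ^+ 2 - n)) <= n * a.
  have -> : th * (a * n + a ^+ 2 / 2 * (n ^+ 2 - n)) =
            n * a * (th * (1 + a * (n - 1) / 2)) by rewrite /th; field.
  apply: ler_piMr; first by rewrite mulr_ge0.
  have h : 1 + a * (n - 1) / 2 <= 1 + K * a by nra.
  apply: le_trans (ler_wpM2l th0 h) _; rewrite /th.
  have : 0 <= (K * a) ^+ 2 by apply: sqr_ge0.
  nra.
have h : 0 <= f x * (S - th * (a * n + a ^+ 2 / 2 * (n ^+ 2 - n))).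
  by rewrite mulr_ge0//; lra.
have h4 : 0 <= (f x - a) * (th * (a * n)).
  by rewrite mulr_ge0 ?subr_ge0// !mulr_ge0.
nra.
Qed.

Lemma prod_onem_ge xs f : (forall x, x \in xs -> 0 <= f x <= 1) ->
  1 - \sum_(x <- xs) f x <= \prod_(x <- xs) (1 - f x).
Proof.
move=> f01; have := @prod_onem_ge_pairs xs f 0 (size xs)%:R (lexx _).
rewrite !mulr0 subr0 expr0n /= !mul0r mulr0 addr0; apply=> //; exact: ler01.
Qed.

(** Raising each factor by [q] raises the product most when all the factors
    are [1], since the increment is monotone in the factors. *)
Lemma prod_le_perturb xs f g (q : R) : 0 <= q <= 1 ->
  (forall x, x \in xs -> 0 <= f x <= 1) ->
  (forall x, x \in xs -> 0 <= g x <= 1) ->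
  (forall x, x \in xs -> f x <= g x + q) ->
  \prod_(x <- xs) f x <= \prod_(x <- xs) g x + (1 - \prod_(x <- xs) (1 - q)).
Proof.
move=> /andP[q0 q1]; elim: xs => [|x xs IH] f01 g01 fg.
  by rewrite !big_nil subrr addr0.
have {}IH := IH (fun y yxs => f01 y (mem_tail x yxs))
  (fun y yxs => g01 y (mem_tail x yxs)) (fun y yxs => fg y (mem_tail x yxs)).
have /andP[f0 f1] := prod_unit_interval (fun y yxs => f01 y (mem_tail x yxs)).
have /andP[g0 g1] := prod_unit_interval (fun y yxs => g01 y (mem_tail x yxs)).
have /andP[H0 H1] : 0 <= \prod_(y <- xs) (1 - q) <= 1.
  by apply: prod_unit_interval => y _; lra.
have /andP[fx0 fx1] := f01 x (mem_head _ _).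
have /andP[gx0 gx1] := g01 x (mem_head _ _).
have fgx := fg x (mem_head _ _).
rewrite !big_cons.
set F := \prod_(y <- xs) f y in IH f0 f1 *.
set G := \prod_(y <- xs) g y in IH g0 g1 *.
set H := \prod_(y <- xs) (1 - q) in IH H0 H1 *.
have qH : (1 - q) * H <= 1 - q by rewrite ler_piMr// subr_ge0.
have qH0 : 0 <= (1 - q) * H by rewrite mulr_ge0// subr_ge0.
have gG : 0 <= g x * G by rewrite mulr_ge0.
have [fxq|qfx] := leP (f x) q.
  by have : f x * F <= f x by [rewrite ler_piMr]; lra.
have h1 : (f x - q) * G <= g x * G by rewrite ler_wpM2r//; lra.
have h2 : (f x - q) * (F - G) <= (f x - q) * (1 - H) by rewrite ler_wpM2l//; lra.
have h3 : (f x - q) * (1 - H) <= (1 - q) * (1 - H) by rewrite ler_wpM2r//; lra.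
have h4 : q * F <= q by rewrite ler_piMr.
nra.
Qed.

End ProductBounds.

(** * Second-order expansion of the inverse square *)

Section RealBounds.
Context {R : realType}.
Implicit Types (h e : R).

(** Everything rests on [1 - (1 + 2 h) (1 - h)^2 = h^2 (3 - 2 h)]. *)
Lemma inv_sqr_onem_le h e : 0 <= e < 1 -> h <= e ->
  ((1 - h) ^+ 2)^-1 <= 1 + 2 * h + 3 / (1 - e) ^+ 2 * h ^+ 2.
Proof.
move=> /andP[e0 e1] he.
have p0 : 0 < (1 - h) ^+ 2 by rewrite exprn_gt0//; lra.
have e2 : 0 < (1 - e) ^+ 2 by rewrite exprn_gt0//; lra.
rewrite -[leLHS]mul1r ler_pdivrMr//.
have k3 : 3 <= 3 / (1 - e) ^+ 2 * 1 by rewrite mulr1 ler_pdivlMr//; nra.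
have k : (3 - 2 * h) <= 3 / (1 - e) ^+ 2 * (1 - h) ^+ 2.
  have [h0|h0] := leP h 0.
    have : 3 * (1 - h) ^+ 2 <= 3 / (1 - e) ^+ 2 * (1 - h) ^+ 2.
      by rewrite ler_wpM2r// ?sqr_ge0//; lra.
    nra.
  rewrite mulrAC ler_pdivlMr//.
  have : (3 - 2 * h) * (1 - e) ^+ 2 <= 3 * (1 - e) ^+ 2 by rewrite ler_wpM2r ?sqr_ge0//; lra.
  have : (1 - e) ^+ 2 <= (1 - h) ^+ 2 by rewrite ler_pXn2r// ?nnegrE; lra.
  lra.
have := ler_wpM2l (sqr_ge0 h) k; nra.
Qed.

Lemma inv_sqr_onem_ge_linear h : h < 1 -> 1 + 2 * h <= ((1 - h) ^+ 2)^-1.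
Proof.
move=> h1; have p0 : 0 < (1 - h) ^+ 2 by rewrite exprn_gt0//; lra.
rewrite -[leRHS]mul1r ler_pdivlMr//.
have : 0 <= h ^+ 2 * (3 - 2 * h) by rewrite mulr_ge0 ?sqr_ge0//; lra.
nra.
Qed.

Lemma inv_sqr_onem_ge h e : e < 1 -> `|h| <= e ->
  1 + 2 * h + 3 / (1 + e) ^+ 2 * h ^+ 2 <= ((1 - h) ^+ 2)^-1.
Proof.
move=> e1; rewrite ler_norml => /andP[eh he].
have e0 : 0 <= e by lra.
have p0 : 0 < (1 - h) ^+ 2 by rewrite exprn_gt0//; lra.
have e2 : 0 < (1 + e) ^+ 2 by rewrite exprn_gt0//; lra.
rewrite -[leRHS]mul1r ler_pdivlMr//.
have k : 3 / (1 + e) ^+ 2 * (1 - h) ^+ 2 <= 3 - 2 * h.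
  rewrite mulrAC ler_pdivrMr//.
  have [h0|h0] := leP h 0.
    have : (1 - h) ^+ 2 <= (1 + e) ^+ 2 by rewrite ler_pXn2r// ?nnegrE; lra.
    nra.
  have : 3 * (1 - h) ^+ 2 <= 3 - 2 * h by nra.
  have : (3 - 2 * h) * 1 <= (3 - 2 * h) * (1 + e) ^+ 2 by rewrite ler_wpM2l//; nra.
  lra.
have := ler_wpM2l (sqr_ge0 h) k; nra.
Qed.

End RealBounds.

Section Taylor.
Context {R : realType}.
Implicit Types (xs : seq R) (c e k y K : R).

(** The expansion of [c / (y - x) ^+ 2] at [x = 0], with the exact coefficient
    [3] of the quadratic term relaxed to [k]. *)
Definition taylor c k y x : R := c / y ^+ 2 * (1 + 2 * (x / y) + k * (x / y) ^+ 2).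

Lemma sum_taylor xs c k y : \sum_(x <- xs) taylor c k y x =
  c / y ^+ 2 * (size xs)%:R + 2 * c / y ^+ 3 * (\sum_(x <- xs) x ^+ 1)
    + c * k / y ^+ 4 * (\sum_(x <- xs) x ^+ 2).
Proof.
elim: xs => [|x xs IH]; first by rewrite !big_nil /= !mulr0 !addr0.
rewrite !big_cons IH /= -[(size xs).+1%:R]natr1 /taylor !exprMn !exprVn expr1.
have -> : y ^- 3 = y ^- 2 / y by rewrite -!exprVn exprSr.
have -> : y ^- 4 = y ^- 2 * y ^- 2 by rewrite -!exprVn -exprD.
ring.
Qed.

Lemma inv_sqr_sub c y x : y != 0 ->
  c / (y - x) ^+ 2 = c / y ^+ 2 * ((1 - x / y) ^+ 2)^-1.
Proof.
move=> y0; have -> : y - x = y * (1 - x / y) by field.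
by rewrite exprMn invfM mulrA.
Qed.

(** The discriminant of [1 + 2 h + k h^2] is not positive.  This lets the upper
    bound be extended to configurations where it is not an expansion. *)
Lemma taylor_ge0 c k y x : 0 <= c -> 1 <= k -> 0 <= taylor c k y x.
Proof.
move=> c0 k1; rewrite /taylor mulr_ge0//; first by rewrite divr_ge0// sqr_ge0.
set h := x / y; have : 0 <= (1 + h) ^+ 2 by rewrite sqr_ge0.
have : h ^+ 2 <= k * h ^+ 2 by rewrite ler_peMl// sqr_ge0.
nra.
Qed.

Lemma taylor_upper c e y x : 0 <= c -> 0 <= e < 1 -> 0 < y -> x <= e * y ->
  c / (y - x) ^+ 2 <= taylor c (3 / (1 - e) ^+ 2) y x.
Proof.
move=> c0 e01 y0 xe; rewrite inv_sqr_sub ?gt_eqF// /taylor.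
apply: ler_wpM2l; first by rewrite divr_ge0// sqr_ge0.
by apply: inv_sqr_onem_le => //; rewrite ler_pdivrMr.
Qed.

Lemma taylor_lower c e y x : 0 <= c -> 0 <= e < 1 -> 0 < y -> `|x| <= e * y ->
  taylor c (3 / (1 + e) ^+ 2) y x <= c / (y - x) ^+ 2.
Proof.
move=> c0 /andP[e0 e1] y0 xe; rewrite inv_sqr_sub ?gt_eqF// /taylor.
apply: ler_wpM2l; first by rewrite divr_ge0// sqr_ge0.
apply: inv_sqr_onem_ge => //.
by rewrite normrM normfV (gtr0_norm y0) ler_pdivrMr.
Qed.

(** The coefficient makes the left-hand side nonpositive for
    [x > e * y], where no lower bound on the truncated function is available. *)
Lemma taylor_lower_penalized c e y x : 0 <= c -> 0 < e < 1 -> 0 < y ->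
  taylor c (3 / (1 + e) ^+ 2) y x - (3 + 2 / e + (e ^+ 2)^-1) * (c / y ^+ 4) * x ^+ 2
  <= (if x <= e * y then c / (y - x) ^+ 2 else 0).
Proof.
move=> c0 /andP[e0 e1] y0.
have cy : 0 <= c / y ^+ 2 by rewrite divr_ge0// sqr_ge0.
have -> : (3 + 2 / e + (e ^+ 2)^-1) * (c / y ^+ 4) * x ^+ 2 =
    c / y ^+ 2 * ((3 + 2 / e + (e ^+ 2)^-1) * (x / y) ^+ 2).
  by field; rewrite !gt_eqF.
rewrite /taylor -mulrBr; set h := x / y.
have k3 : 3 / (1 + e) ^+ 2 <= 3.
  rewrite ler_pdivrMr; last by rewrite exprn_gt0//; lra.
  by have := sqr_ge0 e; nra.
have kh : 3 / (1 + e) ^+ 2 * h ^+ 2 <= 3 * h ^+ 2 by rewrite ler_wpM2r// sqr_ge0.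
have ie0 : 0 < e^-1 by rewrite invr_gt0.
have A0 : 0 <= 2 / e * h ^+ 2 by rewrite mulr_ge0 ?sqr_ge0// divr_ge0// ltW.
have B0 : 0 <= (e ^+ 2)^-1 * h ^+ 2 by rewrite mulr_ge0 ?sqr_ge0// invr_ge0 sqr_ge0.
case: ifPn => [xe|].
  rewrite inv_sqr_sub ?gt_eqF//; apply: ler_wpM2l => //.
  have := @inv_sqr_onem_ge_linear _ h; rewrite -/h.
  have : h <= e by rewrite ler_pdivrMr.
  by move=> he /(_ (le_lt_trans he e1)); lra.
rewrite -ltNge => xe; apply: mulr_ge0_le0 => //.
have eh : e < h by rewrite ltr_pdivlMr.
have eh1 : 1 <= h / e by rewrite ler_pdivlMr// mul1r ltW.
have -> : (3 + 2 / e + (e ^+ 2)^-1) * h ^+ 2 =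
  3 * h ^+ 2 + 2 * (h * (h / e)) + (h / e) ^+ 2 by field; rewrite gt_eqF.
have : h * 1 <= h * (h / e) by rewrite ler_wpM2l//; lra.
have : 1 * 1 <= (h / e) * (h / e) by apply: ler_pM.
lra.
Qed.

Lemma onem_prod_le_taylor xs (g : R -> R) t y e c : 0 <= c -> 0 <= e < 1 -> 0 < y ->
  c <= ((1 - e) * y) ^+ 2 ->
  (forall x, x \in xs -> x <= e * y) ->
  (forall x, x \in xs -> 1 - c / (y - x) ^+ 2 <= g (t - x)) ->
  1 - \prod_(x <- xs) g (t - x) <=
    \sum_(x <- xs) taylor c (3 / (1 - e) ^+ 2) y x /\
  (forall K, K <= e * y -> (size xs)%:R <= K -> (forall x, x \in xs -> - K <= x) ->
    K * (c / ((1 + e) * y) ^+ 2) <= 1 ->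
  1 - \prod_(x <- xs) g (t - x) <=
    \sum_(x <- xs) taylor c (3 / (1 - e) ^+ 2) y x -
    (1 - K * (c / ((1 + e) * y) ^+ 2)) *
      ((c / ((1 + e) * y) ^+ 2) ^+ 2 / 2 * ((size xs)%:R ^+ 2 - (size xs)%:R))).
Proof.
move=> c0 e01 y0 cy xe gx; have /andP[e0 e1] := e01.
pose b x := c / (y - x) ^+ 2.
have yx x : x \in xs -> 0 < (1 - e) * y <= y - x.
  move=> /xe xey; apply/andP; split; first by rewrite mulr_gt0// subr_gt0.
  lra.
have b01 x : x \in xs -> 0 <= b x <= 1.
  move=> /yx /andP[p0 pyx]; rewrite divr_ge0 ?sqr_ge0//=.
  rewrite ler_pdivrMr ?exprn_gt0 ?(lt_le_trans p0)// mul1r (le_trans cy)//.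
  by rewrite lerXn2r ?nnegrE ?(ltW p0)// (le_trans (ltW p0)).
have prod_b : \prod_(x <- xs) (1 - b x) <= \prod_(x <- xs) g (t - x).
  rewrite big_seq [leRHS]big_seq; apply: ler_prod => x xxs.
  rewrite subr_ge0; have /andP[_ ->] := b01 x xxs; exact: gx.
have sum_b : \sum_(x <- xs) b x <= \sum_(x <- xs) taylor c (3 / (1 - e) ^+ 2) y x.
  rewrite big_seq [leRHS]big_seq; apply: ler_sum => x xxs.
  by apply: taylor_upper => //; exact: xe.
split; first by have := prod_onem_ge b01; lra.
move=> K Key szK xK Ka.
have := @prod_onem_ge_pairs _ _ xs b (c / ((1 + e) * y) ^+ 2) K _ Ka szK _.
have a0 : 0 <= c / ((1 + e) * y) ^+ 2 by rewrite divr_ge0 ?sqr_ge0.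
suff ab x : x \in xs -> c / ((1 + e) * y) ^+ 2 <= b x <= 1.
  by move=> /(_ a0 ab); lra.
move=> xxs; have /andP[_ ->] := b01 x xxs; rewrite andbT.
have /andP[p0 pyx] := yx x xxs; have q0 := lt_le_trans p0 pyx.
apply: ler_wpM2l => //; rewrite lef_pV2 ?posrE ?exprn_gt0//; last by rewrite mulr_gt0//; lra.
have := xK x xxs => Kx.
by rewrite lerXn2r ?nnegrE ?(ltW q0)//; [rewrite mulr_ge0 ?ltW//; lra|lra].
Qed.

Lemma prod_le_taylor xs y e c : 0 <= c -> 0 < e < 1 -> 0 < y ->
  c <= ((1 - e) * y) ^+ 2 ->
  let b x := if x <= e * y then c / (y - x) ^+ 2 else 0 in
  (forall x, 0 <= b x <= 1) /\
  let bound := 1 - \sum_(x <- xs) taylor c (3 / (1 + e) ^+ 2) y x +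
    (c / ((1 - e) * y) ^+ 2) ^+ 2 / 2 * ((size xs)%:R ^+ 2 - (size xs)%:R) in
  ((forall x, x \in xs -> `|x| <= e * y) -> \prod_(x <- xs) (1 - b x) <= bound) /\
  \prod_(x <- xs) (1 - b x) <= bound +
    (3 + 2 / e + (e ^+ 2)^-1) * (c / y ^+ 4) * \sum_(x <- xs) x ^+ 2.
Proof.
move=> c0 /andP[e0 e1] y0 cy b.
have p0 : 0 < (1 - e) * y by rewrite mulr_gt0// subr_gt0.
set B := c / ((1 - e) * y) ^+ 2.
have B1 : B <= 1 by rewrite ler_pdivrMr ?exprn_gt0// mul1r.
have bB x : 0 <= b x <= B.
  rewrite /b; case: ifP => xe; last by rewrite lexx /= divr_ge0// sqr_ge0.
  have pyx : (1 - e) * y <= y - x by lra.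
  rewrite divr_ge0 ?sqr_ge0//=; apply: ler_wpM2l => //.
  rewrite lef_pV2 ?posrE ?exprn_gt0 ?(lt_le_trans p0)//.
  by rewrite lerXn2r ?nnegrE ?(ltW p0)// (le_trans (ltW p0)).
split; first by move=> x; have /andP[-> /le_trans->] := bB x.
have := @prod_onem_le_pairs _ _ xs b B B1 (fun x _ => bB x) => H.
move=> bound; split=> [xe|]; apply: le_trans H _; rewrite /bound.
  have : \sum_(x <- xs) taylor c (3 / (1 + e) ^+ 2) y x <= \sum_(x <- xs) b x.
    rewrite big_seq [leRHS]big_seq; apply: ler_sum => x xxs.
    have {}xe := xe x xxs; rewrite /b (le_trans (ler_norm x) xe).
    by apply: taylor_lower => //; rewrite e1 ltW.
  lra.
have : \sum_(x <- xs) taylor c (3 / (1 + e) ^+ 2) y x -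
    (3 + 2 / e + (e ^+ 2)^-1) * (c / y ^+ 4) * \sum_(x <- xs) x ^+ 2 <=
    \sum_(x <- xs) b x.
  rewrite mulr_sumr -sumrB; apply: ler_sum => x _.
  by apply: taylor_lower_penalized => //; rewrite e0.
lra.
Qed.

(** The strict gain below the linear bound comes from [prod_onem_ge_pairs] with
    [a = q / (2 * K)], small enough for [K * a <= 1 / 2] whatever [q] is. *)
Lemma onem_prod_const_le xs (K q : R) : 1 <= K -> 0 <= q <= 1 ->
  1 - \prod_(x <- xs) (1 - q) <= q * (size xs)%:R /\
  ((size xs)%:R <= K -> 1 - \prod_(x <- xs) (1 - q) <= q * (size xs)%:R -
    q ^+ 2 / (16 * K ^+ 2) * ((size xs)%:R ^+ 2 - (size xs)%:R)).
Proof.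
move=> K1 /andP[q0 q1].
have sumq : \sum_(x <- xs) q = q * (size xs)%:R.
  by rewrite big_const_seq count_predT iter_addr_0 mulr_natr.
split.
  have q01 x : x \in xs -> 0 <= q <= 1 by rewrite q0.
  by have := prod_onem_ge q01; rewrite sumq; lra.
move=> nK; have K0 : 0 < K by lra.
have Kq : K * (q / (2 * K)) = q / 2 by field; rewrite gt_eqF.
have := @prod_onem_ge_pairs _ _ xs (fun=> q) (q / (2 * K)) K.
rewrite Kq sumq => H.
have a0 : 0 <= q / (2 * K) by rewrite divr_ge0// mulr_ge0// ltW.
have qa : q / (2 * K) <= q by rewrite ler_pdivrMr ?mulr_gt0//; nra.
have nn : 0 <= (size xs)%:R ^+ 2 - (size xs)%:R :> R.
  case: (size xs) => [|m]; first by rewrite expr0n subr0.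
  by rewrite -natr1; have := ler0n R m; nra.
set V := _ - _ in nn H *.
have -> : q ^+ 2 / (16 * K ^+ 2) * V = 1 / 2 * ((q / (2 * K)) ^+ 2 / 2 * V).
  by field; rewrite gt_eqF.
have : 1 / 2 * ((q / (2 * K)) ^+ 2 / 2 * V) <=
  (1 - q / 2) * ((q / (2 * K)) ^+ 2 / 2 * V).
  apply: ler_wpM2r; first by rewrite mulr_ge0// divr_ge0// sqr_ge0.
  lra.
have q2 : q / 2 <= 1 by lra.
have aq1 x : x \in xs -> q / (2 * K) <= q <= 1 by rewrite qa.
by have := H a0 q2 nK aq1; lra.
Qed.

End Taylor.

(** * The recursion q - c q^2 *)

Section Logistic.
Context {R : realType}.
Implicit Types (e c q : R).

(** The probabilities that a critical tree survives [n] generations satisfy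
    this recursion as an inequality. *)
Fixpoint logistic c n : R :=
  if n is n'.+1 then logistic c n' - c * logistic c n' ^+ 2 else 1.

Lemma logistic_unit_interval c n : 0 <= c <= 1 -> 0 <= logistic c n <= 1.
Proof.
move=> /andP[c0 c1]; elim: n => [|n /andP[l0 l1]] /=; first by rewrite ler01 lexx.
set q := logistic c n in l0 l1 *.
have : c * q ^+ 2 <= q.
  apply: (@le_trans _ _ (1 * q ^+ 2)); first by rewrite ler_wpM2r ?sqr_ge0.
  by rewrite mul1r expr2 ler_piMr.
have : 0 <= c * q ^+ 2 by rewrite mulr_ge0// sqr_ge0.
by move=> ? ?; apply/andP; split; lra.
Qed.

(** While the sequence stays above [e], each step loses at least [c * e ^+ 2]. *)
Lemma logistic_small c e : 0 < c <= 1 -> 0 < e -> exists n, logistic c n < e.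
Proof.
move=> /andP[c0 c1] e0; apply: contrapT => /forallNP H.
have {}H n : e <= logistic c n by rewrite leNgt; apply/negP/H.
have K n : logistic c n <= 1 - n%:R * (c * e ^+ 2).
  elim: n => [|n IH] /=; first by rewrite mul0r subr0.
  have : c * e ^+ 2 <= c * logistic c n ^+ 2.
    apply: ler_wpM2l; first exact: ltW.
    by apply: lerXn2r; rewrite ?nnegrE// ?(le_trans (ltW e0))// ltW.
  by rewrite -natr1; lra.
have d0 : 0 < c * e ^+ 2 by rewrite mulr_gt0// exprn_gt0.
have := archi_boundP (ltW (divr_gt0 ltr01 d0)).
set m := Num.bound _; rewrite ltr_pdivrMr// => hm.
by have := K m; have := H m; lra.
Qed.

End Logistic.

(** * Choice of the constants *)

Section Constants.
Context {R : realType}.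
Implicit Types (a b c e h v r B : R).

Let inv_sqr_onem_le6 e : 0 < e <= 1 / 2 -> ((1 - e) ^+ 2)^-1 <= 1 + 6 * e.
Proof.
move=> /andP[e0 e1]; rewrite -[leLHS]mul1r ler_pdivrMr ?exprn_gt0//; last by lra.
have : 0 <= e * (1 / 2 - e) by rewrite mulr_ge0//; lra.
have : 0 <= e * (e * (1 / 2 - e)) by rewrite mulr_ge0 ?mulr_ge0//; lra.
nra.
Qed.

Let inv_sqr_oned_ge2 e : 0 < e <= 1 / 2 -> 1 - 2 * e <= ((1 + e) ^+ 2)^-1.
Proof.
move=> /andP[e0 e1]; rewrite -[leRHS]mul1r ler_pdivlMr ?exprn_gt0//; last by lra.
have := sqr_ge0 e; have : 0 <= e * (e * e) by rewrite !mulr_ge0// ltW.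
nra.
Qed.

(** At [e = 0] the inequality is [3 c h < c^2 v / 2]; the witness
    is explicit because all the factors are bounded by affine functions of [e]. *)
Lemma exists_eps_upper c h v : 0 < c -> 0 <= h -> 0 < v -> 6 * h < c * v ->
  exists e, [/\ 0 < e <= 1 / 2, e <= v &
    e + c * (3 / (1 - e) ^+ 2) * h <=
    (1 - e) * ((c / (1 + e) ^+ 2) ^+ 2 / 2 * (v - e))].
Proof.
move=> c0 h0 v0 hcv.
(* [D] collects the terms of first order in [e], after the bounds
   [(1 - e)^-2 <= 1 + 6 e] and [(1 + e)^-2 >= 1 - 2 e]. *)
pose D := 1 + 18 * c * h + 5 * c ^+ 2 * v + c ^+ 2.
have D0 : 0 < D.
  have := mulr_ge0 (ltW c0) h0; have := sqr_ge0 c.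
  have := mulr_ge0 (sqr_ge0 c) (ltW v0).
  by rewrite /D; lra.
pose gap := c * (c * v - 6 * h) / 2.
have gap0 : 0 < gap by rewrite /gap divr_gt0// mulr_gt0// subr_gt0.
pose e := Num.min (1 / 2) (Num.min v (gap / D)).
have half : 0 < 1 / 2 :> R by lra.
have gD : 0 < gap / D by rewrite divr_gt0.
have e0 : 0 < e by rewrite /e !lt_min half v0 gD.
have e1 : e <= 1 / 2 by rewrite /e ge_min lexx.
have ev : e <= v by rewrite /e !ge_min lexx orbT.
have eD : e * D <= gap by rewrite -ler_pdivlMr// /e !ge_min lexx !orbT.
exists e; split => //; first by rewrite e0 e1.
have e01 : 0 < e <= 1 / 2 by rewrite e0 e1.
have U := inv_sqr_onem_le6 e01; have V := inv_sqr_oned_ge2 e01.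
have ch0 : 0 <= 3 * c * h by rewrite !mulr_ge0// ltW.
have L1 : c * (3 / (1 - e) ^+ 2) * h <= 3 * c * h * (1 + 6 * e).
  rewrite (_ : c * _ * h = 3 * c * h * ((1 - e) ^+ 2)^-1); last by ring.
  exact: ler_wpM2l.
have V2 : (1 - 2 * e) ^+ 2 <= (((1 + e) ^+ 2)^-1) ^+ 2.
  by apply: lerXn2r; rewrite ?nnegrE ?invr_ge0 ?sqr_ge0//; lra.
have L2 : (1 - e) * (c ^+ 2 * (1 - 2 * e) ^+ 2 / 2 * (v - e)) <=
    (1 - e) * ((c / (1 + e) ^+ 2) ^+ 2 / 2 * (v - e)).
  apply: ler_wpM2l; first by lra.
  apply: ler_wpM2r; first by lra.
  rewrite ler_pM2r ?invr_gt0// exprMn; apply: ler_wpM2l => //; exact: sqr_ge0.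
apply: le_trans L2; apply: le_trans (lerD (lexx e) L1) _.
have c2 : 0 <= c ^+ 2 by apply: sqr_ge0.
have k1 : 1 - 5 * e <= (1 - e) * (1 - 2 * e) ^+ 2 by nra.
have k2 : (1 - 5 * e) * (v - e) <= (1 - e) * (1 - 2 * e) ^+ 2 * (v - e).
  by rewrite ler_wpM2r//; lra.
have k3 : v - 5 * e * v - e <= (1 - 5 * e) * (v - e) by nra.
have k4 : c ^+ 2 / 2 * (v - 5 * e * v - e) <=
    (1 - e) * (c ^+ 2 * (1 - 2 * e) ^+ 2 / 2 * (v - e)).
  rewrite (_ : (1 - e) * _ = c ^+ 2 / 2 * ((1 - e) * (1 - 2 * e) ^+ 2 * (v - e))); last by field.
  by apply: ler_wpM2l; [rewrite divr_ge0|lra].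
apply: le_trans k4; move: eD; rewrite /D /gap => eD.
have : 0 <= e * (c ^+ 2 * v) by rewrite !mulr_ge0// ltW.
have : 0 <= e * c ^+ 2 by rewrite mulr_ge0// ltW.
lra.
Qed.

(** Here [e] is fixed first; its negative powers are then compensated by [d]. *)
Lemma exists_eps_lower c h v : 0 < c -> 0 <= h -> 0 < v -> c * v < 6 * h ->
  exists e d, [/\ 0 < e <= 1 / 2, 0 < d &
    (c / (1 - e) ^+ 2) ^+ 2 / 2 * v + (3 + 2 / e + (e ^+ 2)^-1) * c * d <=
    c * (3 / (1 + e) ^+ 2) * h].
Proof.
move=> c0 h0 v0 cvh.
pose gap := c * (6 * h - c * v) / 2.
have gap0 : 0 < gap by rewrite /gap divr_gt0// mulr_gt0// subr_gt0.
pose D := 1 + 6 * c * h + 15 * c ^+ 2 * v.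
have D0 : 0 < D.
  have := mulr_ge0 (ltW c0) h0; have := sqr_ge0 c.
  have := mulr_ge0 (sqr_ge0 c) (ltW v0).
  by rewrite /D; lra.
pose e := Num.min (1 / 2) (gap / 2 / D).
have half : 0 < 1 / 2 :> R by lra.
have gD : 0 < gap / 2 / D by rewrite divr_gt0// divr_gt0.
have e0 : 0 < e by rewrite /e lt_min half gD.
have e1 : e <= 1 / 2 by rewrite /e ge_min lexx.
have eD : e * D <= gap / 2 by rewrite -ler_pdivlMr// /e ge_min lexx orbT.
have C0 : 0 < (3 + 2 / e + (e ^+ 2)^-1) * c.
  rewrite mulr_gt0//; have i0 : 0 < e^-1 by rewrite invr_gt0.
  have : 0 < (e ^+ 2)^-1 by rewrite invr_gt0 exprn_gt0.
  by rewrite addrC => ?; rewrite !addr_gt0// mulr_gt0.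
set C := (_ * c) in C0.
exists e, (gap / 2 / C); split.
- by rewrite e0 e1.
- by rewrite divr_gt0// divr_gt0.
rewrite -/C [C * _]mulrC divfK ?gt_eqF//.
have e01 : 0 < e <= 1 / 2 by rewrite e0 e1.
have U := inv_sqr_onem_le6 e01; have V := inv_sqr_oned_ge2 e01.
have L1 : 3 * c * h * (1 - 2 * e) <= c * (3 / (1 + e) ^+ 2) * h.
  rewrite (_ : c * _ * h = 3 * c * h * ((1 + e) ^+ 2)^-1); last by ring.
  by apply: ler_wpM2l => //; rewrite !mulr_ge0// ltW.
have U2 : (((1 - e) ^+ 2)^-1) ^+ 2 <= (1 + 6 * e) ^+ 2.
  by apply: lerXn2r; rewrite ?nnegrE ?invr_ge0 ?sqr_ge0//; lra.
have U3 : (1 + 6 * e) ^+ 2 <= 1 + 30 * e by nra.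
have cv0 : 0 <= c ^+ 2 / 2 * v by rewrite mulr_ge0 ?divr_ge0 ?sqr_ge0// ltW.
have L2 : (c / (1 - e) ^+ 2) ^+ 2 / 2 * v <= c ^+ 2 / 2 * v * (1 + 30 * e).
  rewrite exprMn (_ : _ / 2 * v = c ^+ 2 / 2 * v * (((1 - e) ^+ 2)^-1) ^+ 2); last by ring.
  by apply: ler_wpM2l => //; lra.
apply: le_trans L1; apply: le_trans (lerD L2 (lexx _)) _.
move: eD; rewrite /D /gap; lra.
Qed.

(** With [h = eta^2] and [v = sigma^2], this is where [c > 6 h / v] makes the
    quadratic gain of the product outweigh the convexity of [c / y^2] and the
    probability of a large jump; all the terms have order [y^-4]. *)
Lemma upper_gain c h v e m K y : 0 < c -> 0 < e <= 1 / 2 -> e <= v -> m <= e ->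
  0 < y -> 0 <= K * c <= e * y ^+ 2 ->
  e + c * (3 / (1 - e) ^+ 2) * h <=
    (1 - e) * ((c / (1 + e) ^+ 2) ^+ 2 / 2 * (v - e)) ->
  let a := c / ((1 + e) * y) ^+ 2 in K * a <= e /\
  e / y ^+ 4 + c * (3 / (1 - e) ^+ 2) / y ^+ 4 * h <=
    (1 - K * a) * (a ^+ 2 / 2) * (v - m).
Proof.
move=> c0 /andP[e0 e1] ev me y0 /andP[Kc0 Kc] He a.
have y4 : 0 < y ^+ 4 by rewrite exprn_gt0.
have Ka : K * a <= e.
  rewrite /a mulrA ler_pdivrMr ?exprn_gt0 ?mulr_gt0//; last by lra.
  have : y ^+ 2 <= ((1 + e) * y) ^+ 2.
    by apply: lerXn2r; rewrite ?nnegrE ?mulr_ge0//; nra.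
  by move=> /(ler_wpM2l (ltW e0)); lra.
split=> //.
apply: (@le_trans _ _ ((1 - e) * ((c / (1 + e) ^+ 2) ^+ 2 / 2 * (v - e)) / y ^+ 4)).
  rewrite ler_pdivlMr// mulrDl divfK ?gt_eqF//.
  rewrite (_ : _ / y ^+ 4 * h * y ^+ 4 = c * (3 / (1 - e) ^+ 2) * h)//.
  by rewrite mulrAC [_ / _ * _]mulrAC mulfK ?gt_eqF// mulrAC.
have -> : (1 - e) * ((c / (1 + e) ^+ 2) ^+ 2 / 2 * (v - e)) / y ^+ 4 =
    (1 - e) * (v - e) * (a ^+ 2 / 2).
  by rewrite /a; field; rewrite !gt_eqF//; lra.
rewrite [leRHS]mulrAC; apply: ler_wpM2r; first by rewrite divr_ge0 ?sqr_ge0.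
by apply: ler_pM; lra.
Qed.

(** The counterpart of [upper_gain] for [c < 6 h / v]: convexity outweighs
    the quadratic loss and the penalty for large jumps. *)
Lemma lower_gain c h v e p m s : 0 < c -> 0 < e <= 1 / 2 -> m <= p -> 0 < s ->
  (c / (1 - e) ^+ 2) ^+ 2 / 2 * v + (3 + 2 / e + (e ^+ 2)^-1) * c * p <=
    c * (3 / (1 + e) ^+ 2) * h ->
  (c / ((1 - e) * s) ^+ 2) ^+ 2 / 2 * v +
    (3 + 2 / e + (e ^+ 2)^-1) * (c / s ^+ 4) * m <=
  c * (3 / (1 + e) ^+ 2) / s ^+ 4 * h.
Proof.
move=> c0 /andP[e0 e1] mp s0 He.
have s4 : 0 < s ^+ 4 by rewrite exprn_gt0.
have i0 : 0 < e^-1 by rewrite invr_gt0.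
have i2 : 0 < (e ^+ 2)^-1 by rewrite invr_gt0 exprn_gt0.
have C0 : 0 <= (3 + 2 / e + (e ^+ 2)^-1) * (c / s ^+ 4).
  by apply: mulr_ge0; [lra|rewrite divr_ge0// ltW].
have -> : c * (3 / (1 + e) ^+ 2) / s ^+ 4 * h =
  (c * (3 / (1 + e) ^+ 2) * h) / s ^+ 4 by ring.
apply: le_trans (lerD (lexx _) (ler_wpM2l C0 mp)) _; rewrite ler_pdivlMr//.
apply: le_trans He; rewrite le_eqVlt; apply/orP; left; apply/eqP.
by field; rewrite !gt_eqF//; lra.
Qed.

Lemma le_sqr_onem c e y : 0 <= e <= 1 / 2 -> 1 <= y -> 4 * c <= y ->
  c <= ((1 - e) * y) ^+ 2.
Proof.
move=> /andP[e0 e1] y1 cy.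
have : (1 / 2 * y) ^+ 2 <= ((1 - e) * y) ^+ 2.
  by apply: lerXn2r; rewrite ?nnegrE ?mulr_ge0//; nra.
by nra.
Qed.

Lemma shifted_sqr_le a b B : 0 <= a -> a < b -> 0 <= B ->
  exists r0, 0 < r0 /\ forall r, r0 <= r -> a * (r + B) ^+ 2 <= b * r ^+ 2.
Proof.
move=> a0 ab B0; exists (1 + B + 3 * a * B / (b - a)).
have q0 : 0 <= 3 * a * B / (b - a) by rewrite divr_ge0 ?mulr_ge0//; lra.
split=> [|r hr]; first by lra.
have rB : B <= r by lra.
have : 3 * a * B <= (b - a) * r.
  by rewrite mulrC [_ * r]mulrC -ler_pdivrMr ?subr_gt0// mulrC; lra.
move=> H; have r0 : 0 <= r by lra.
have H1 := ler_wpM2r r0 H.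
have H2 : a * B * B <= a * B * r by rewrite ler_wpM2l// mulr_ge0.
nra.
Qed.

End Constants.

Section InverseSquare.
Context {R : realType}.
Implicit Types (u : R -> R) (C : R).

Lemma inverse_square_upper u C (e : R) : 0 < C -> 0 < e ->
  (forall c, C < c -> exists A L, [/\ 0 < L, L <= A &
     forall t, A <= t -> u t <= c / (t - A + L) ^+ 2]) ->
  exists r0, forall r, r0 <= r -> u r <= (1 + e) * (C / r ^+ 2).
Proof.
move=> C0 e0 Hu.
have [|A [L [L0 LA HA]]] := Hu (C * (1 + e / 2)).
  by rewrite ltr_pMr//; lra.
have [| | |s0 [s0p Hs]] := @shifted_sqr_le R (1 + e / 2) (1 + e) (A - L); [lra..|].
exists (A + s0) => r hr; apply: le_trans (HA r _) _; first by lra.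
have s1 : s0 <= r - A + L by lra.
have := Hs _ s1; rewrite (_ : r - A + L + (A - L) = r); last by ring.
set s := r - A + L in s1 *.
have s2 : 0 < s ^+ 2 by rewrite exprn_gt0//; lra.
have r2 : 0 < r ^+ 2 by rewrite exprn_gt0//; lra.
move=> H; rewrite ler_pdivrMr//.
have -> : (1 + e) * (C / r ^+ 2) * s ^+ 2 = C * ((1 + e) * s ^+ 2) / r ^+ 2 by ring.
by rewrite ler_pdivlMr// -mulrA ler_pM2l.
Qed.

Lemma inverse_square_lower u C (e : R) : 0 < C -> 0 < e < 1 ->
  (forall c, 0 < c -> c < C -> exists2 L : R, 0 < L &
     forall t, 0 <= t -> c / (t + L) ^+ 2 <= u t) ->
  exists r0, forall r, r0 <= r -> (1 - e) * (C / r ^+ 2) <= u r.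
Proof.
move=> C0 e01 Hu; have /andP[e0 e1] := e01.
have [||L L0 HL] := Hu (C * (1 - e / 2)); first by rewrite mulr_gt0//; lra.
  by rewrite gtr_pMr//; lra.
have [| | |s0 [s0p Hs]] := @shifted_sqr_le R (1 - e) (1 - e / 2) L; [lra..|].
exists s0 => r hr; apply: le_trans (HL r _); last by lra.
have r2 : 0 < r ^+ 2 by rewrite exprn_gt0//; lra.
have s2 : 0 < (r + L) ^+ 2 by rewrite exprn_gt0//; lra.
rewrite ler_pdivlMr//.
have -> : (1 - e) * (C / r ^+ 2) * (r + L) ^+ 2 =
  C * ((1 - e) * (r + L) ^+ 2) / r ^+ 2 by ring.
by rewrite ler_pdivrMr// -mulrA ler_pM2l//; exact: Hs.
Qed.

End InverseSquare.

(** * Integrals over a probability space *)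

Section ProbabilityIntegrals.
Context {R : realType} {d} {W : measurableType d} (P : probability W R).
Implicit Types f g : W -> R.

Lemma integrable_bounded f (M : R) : measurable_fun setT f ->
  (forall w, `|f w| <= M) -> P.-integrable setT (EFin \o f).
Proof.
move=> mf fM.
apply: (@le_integrable _ _ _ P setT measurableT _ (EFin \o cst M)).
- exact/measurable_EFinP.
- by move=> w _ /=; rewrite lee_fin (le_trans (fM w))// ler_norm.
- exact: finite_measure_integrable_cst.
Qed.

Lemma integrable_unit_interval f : measurable_fun setT f ->
  (forall w, 0 <= f w <= 1) -> P.-integrable setT (EFin \o f).
Proof.
move=> mf f01; apply: (@integrable_bounded f 1) => // w.
by have /andP[? ?] := f01 w; rewrite ger0_norm.
Qed.

Lemma Rintegral_unit_interval f : measurable_fun setT f ->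
  (forall w, 0 <= f w <= 1) -> 0 <= \int[P]_w f w <= 1.
Proof.
move=> mf f01; rewrite Rintegral_ge0 /=; last by move=> w _; have /andP[] := f01 w.
have -> : 1 = \int[P]_w (1 : R).
  by rewrite Rintegral_cst// mul1r; have := probability_setT P; rewrite /= => ->.
apply: le_Rintegral => //; first exact: integrable_unit_interval.
- by apply: integrable_unit_interval => // w; rewrite ler01 lexx.
- by move=> w _; have /andP[] := f01 w.
Qed.

Lemma Rintegral_indicator (A : set W) : measurable A ->
  \int[P]_w \1_A w = fine (P A).
Proof. by move=> mA; rewrite /Rintegral integral_indic// setIT. Qed.

Lemma cvg_Rintegral_stationary (F : nat -> W -> R) f g :
  (forall k, measurable_fun setT (F k)) -> P.-integrable setT (EFin \o g) ->
  (forall k w, `|F k w| <= g w) ->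
  (forall w, exists K, forall k, (K <= k)%N -> F k w = f w) ->
  (fun k => \int[P]_w F k w) @ \oo --> \int[P]_w f w.
Proof.
move=> mF ig Fg Ff.
have cF w : (fun k => F k w) @ \oo --> f w.
  have [K HK] := Ff w; apply: cvg_near_cst.
  by exists K => // k /= Kk; rewrite HK.
have mf : measurable_fun setT f.
  by exact: (measurable_fun_cvg mF (fun w _ => cF w)).
have fg w : `|f w| <= g w.
  by have [K HK] := Ff w; rewrite -(HK K).
have intf : P.-integrable setT (EFin \o f).
  apply: (le_integrable _ _ _ ig) => //; first exact/measurable_EFinP.
  by move=> w _ /=; rewrite lee_fin (le_trans (fg w))// ler_norm.
apply: fine_cvg; rewrite fineK; last exact: integrable_fin_num.
apply: (@dominated_cvg _ _ _ P setT measurableT (fun k => EFin \o F k) (EFin \o f)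
  (EFin \o g)) => //.
- by move=> n; exact/measurable_EFinP.
- by move=> w _; apply: cvg_EFin; [exact: nearW|exact: cF].
- by move=> n w _; rewrite /= lee_fin.
Qed.

End ProbabilityIntegrals.

Section Mean.
Context {R : realType} {d} {W : measurableType d} (P : probability W R).
Implicit Types (f g : W -> R) (m a : R).

Definition has_mean f m :=
  P.-integrable setT (EFin \o f) /\ \int[P]_w f w = m.

Lemma has_mean_cst a : has_mean (cst a) a.
Proof.
split; first exact: finite_measure_integrable_cst.
by rewrite Rintegral_cst//; have /= -> := probability_setT P; rewrite mulr1.
Qed.

Lemma has_meanD f g m m' : has_mean f m -> has_mean g m' ->
  has_mean (fun w => f w + g w) (m + m').
Proof.
move=> [iF <-] [iG <-]; split; last by rewrite RintegralD.
exact: (integrableD measurableT iF iG).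
Qed.

Lemma has_meanB f g m m' : has_mean f m -> has_mean g m' ->
  has_mean (fun w => f w - g w) (m - m').
Proof.
move=> [iF <-] [iG <-]; split; last by rewrite RintegralB.
exact: (integrableB measurableT iF iG).
Qed.

Lemma has_meanZ a f m : has_mean f m -> has_mean (fun w => a * f w) (a * m).
Proof.
move=> [iF <-]; split; last by rewrite RintegralZl.
exact: (integrableZl measurableT a iF).
Qed.

Lemma has_mean_measurable f m : has_mean f m -> measurable_fun setT f.
Proof. by move=> [iF _]; apply/measurable_EFinP; exact: measurable_int iF. Qed.

Lemma ae_le_mean f g m m' : has_mean f m -> has_mean g m' ->
  {ae P, forall w, f w <= g w} -> m <= m'.
Proof.
move=> hf hg fg; have [iD ED] := has_meanB hg hf.
rewrite -subr_ge0 -ED.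
have mD := has_mean_measurable (has_meanB hg hf).
have -> : \int[P]_w (g w - f w) = \int[P]_w (Num.max (g w - f w) 0).
  congr fine; apply: ae_eq_integral => //.
  - exact/measurable_EFinP.
  - by apply/measurable_EFinP; exact: measurable_maxr.
  - by apply: filterS fg => w fgw _; rewrite max_l// subr_ge0.
by apply: Rintegral_ge0 => w _; rewrite le_max lexx orbT.
Qed.

Lemma has_mean_unit_interval f : measurable_fun setT f ->
  (forall w, 0 <= f w <= 1) -> has_mean f (\int[P]_w f w).
Proof. by move=> mf f01; split => //; exact: integrable_unit_interval. Qed.

(** Dominated convergence along integer thresholds. *)
Lemma truncated_mean_small f m (Q : W -> R) (e : R) :
  measurable_fun setT Q -> has_mean f m -> (forall w, 0 <= f w) -> 0 < e ->
  exists K m', [/\ 1 <= K, has_mean (fun w => (K < Q w)%R%:R * f w) m' & m' <= e].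
Proof.
move=> mQ hf f0 e0; have mf := has_mean_measurable hf; have [iF _] := hf.
pose F (k : nat) w : R := (k.+1%:R < Q w)%R%:R * f w.
have mb : measurable_fun setT (fun b : bool => b%:R : R) by [].
have mF k : measurable_fun setT (F k).
  apply: measurable_funM => //; apply: (measurableT_comp mb).
  exact: measurable_fun_ltr.
have Ff k w : `|F k w| <= f w.
  rewrite /F normrM ger0_norm ?ler0n// [X in _ * X]ger0_norm//.
  by case: (_ < _); rewrite ?mul1r// mul0r.
have cv : (fun k => \int[P]_w F k w) @ \oo --> \int[P]_w (0 : R).
  apply: (@cvg_Rintegral_stationary _ _ _ P F _ f) => // w.
  exists (Num.bound (Q w)) => k Kk; rewrite /F ltNge (_ : _ <= _) ?mul0r//.
  have [Q0|Q0] := leP (Q w) 0; first by rewrite (le_trans Q0).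
  rewrite ltW// (lt_le_trans (archi_boundP (ltW Q0)))// ler_nat.
  exact: leqW.
have {cv} [k _ Hk] : \forall k \near \oo, \int[P]_w F k w < e.
  by apply: (cvgr_lt _ cv); rewrite Rintegral_cst// mul0r.
exists k.+1%:R, (\int[P]_w F k w); split; first by rewrite ler1n.
- split => //; apply: (le_integrable _ _ _ iF) => //; first by apply/measurable_EFinP; exact: (mF k).
  by move=> w _ /=; rewrite lee_fin (le_trans (Ff k w))// ler_norm.
- by apply: ltW; apply: Hk => /=.
Qed.

End Mean.

(** * Independent sigma-algebras *)

Section IndependentPair.
Context {R : realType} {d} {W : measurableType d} (P : probability W R).

(** Dynkin's theorem is applied twice, once in each argument. *)
Lemma independent_pi_lambda (G H : set (set W)) :
  G `<=` measurable -> setI_closed G ->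
  H `<=` measurable -> setI_closed H ->
  (forall A B, G A -> H B -> P (A `&` B) = (P A * P B)%E) ->
  forall A B, <<s G >> A -> <<s H >> B -> P (A `&` B) = (P A * P B)%E.
Proof.
have step (G' : set (set W)) (B : set W) : G' `<=` measurable ->
    setI_closed G' -> measurable B ->
    (forall A, G' A -> P (A `&` B) = (P A * P B)%E) ->
    forall A, <<s G' >> A -> P (A `&` B) = (P A * P B)%E.
  move=> mG IG mB GB A.
  rewrite -(setI_closed_g_dynkin_g_sigma_algebra IG) => GA.
  suff [] : measurable A /\ P (A `&` B) = (P A * P B)%E by [].
  move: A GA; apply: smallest_sub; last by move=> A GA; split; [exact: mG|exact: GB].
  split.
  - by split => //; rewrite setTI probability_setT mul1e.
  - move=> A [mA AB]; split; first exact: measurableC.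
    rewrite setIC -setDE measureD//; last by rewrite ltey_eq fin_num_measure.
    transitivity (P B - P A * P B)%E; first by congr (_ - _)%E; rewrite setIC; exact: AB.
    by rewrite probability_setC// muleBl ?mul1e ?fin_num_measure// fin_num_adde_defl// fin_num_measure.
  - move=> F tF FB; split; first by apply: bigcup_measurable => k _; have [] := FB k.
    have mF k : measurable (F k) by have [] := FB k.
    rewrite setI_bigcupl !measure_bigcup//; last 2 first.
    + by move=> k _; exact: measurableI.
    + by apply: trivIset_setIr.
    rewrite muleC -(fineK (fin_num_measure P _ mB)) -nneseriesZl//.
    apply: eq_eseriesr => k _; transitivity (P (F k) * P B)%E; first exact: (FB k).2.
    by rewrite fineK ?fin_num_measure// muleC.
move=> mG IG mH IH GH A B sA sB.
have mB : measurable B.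
  by apply: (smallest_sub _ mH) sB; exact: sigma_algebra_measurable.
apply: (step G B mG IG mB) => // C GC.
rewrite setIC muleC; apply: (step H C mH IH (mG _ GC)) => // D HD.
by rewrite setIC muleC; exact: GH.
Qed.

(** Independence says that the law of the pair is the product of the laws, so
    that Tonelli's theorem applies. *)
Lemma ge0_integral_independent {d1 d2} {T1 : measurableType d1}
    {T2 : measurableType d2} (X1 : {RV P >-> T1}) (X2 : {RV P >-> T2})
    (f : T1 * T2 -> \bar R) :
  (forall A B, measurable A -> measurable B ->
     P (X1 @^-1` A `&` X2 @^-1` B) = (P (X1 @^-1` A) * P (X2 @^-1` B))%E) ->
  measurable_fun setT f -> (forall z, 0 <= f z)%E ->
  (\int[P]_w f (X1 w, X2 w) = \int[P]_w \int[P]_w' f (X1 w, X2 w'))%E.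
Proof.
move=> ind mf f0.
have mX : measurable_fun setT (fun w => (X1 w, X2 w)) by apply: measurable_fun_pair.
pose X : {RV P >-> (T1 * T2)%type} :=
  HB.pack (fun w => (X1 w, X2 w)) (isMeasurableFun.Build _ _ _ _ _ mX).
transitivity (\int[distribution P X]_z f z)%E.
  by rewrite ge0_integral_distribution.
transitivity (\int[distribution P X1 \x distribution P X2]_z f z)%E.
  apply: eq_measure_integral => A mA _; apply/esym.
  exact: product_measure_unique.
rewrite fubini_tonelli1//= ge0_integral_distribution//=.
- apply: eq_integral => w _; rewrite /fubini_F/= ge0_integral_distribution//.
  exact: measurableT_comp.
- exact: measurable_fun_fubini_tonelli_F.
- by move=> y; apply: integral_ge0.
Qed.

End IndependentPair.

Lemma bigsetI_seq_forall (I : eqType) T (s : seq I) (F : I -> set T) :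
  \big[setI/setT]_(i <- s) F i = [set w | forall i, i \in s -> F i w].
Proof.
elim: s => [|j s IH]; first by rewrite big_nil; apply/seteqP; split.
rewrite big_cons IH; apply/seteqP; split => w /=.
  by move=> [Fj H] i; rewrite inE => /predU1P[->|/H].
by move=> H; split=> [|i is_]; apply: H; rewrite inE ?eqxx ?is_ ?orbT.
Qed.

Section GeneratedByCoordinates.
Context {R : realType} {I : eqType} {d'} {V : measurableType d'}
  {d} {W : measurableType d} (P : probability W R) (S : I -> {RV P >-> V}).
Implicit Types (J : pred I).

(** A pi-system generating the sigma-algebra of the coordinates in [J].  The
    index list may contain repetitions, which makes stability by intersection a
    concatenation. *)
Definition cylinders J : set (set W) :=
  [set A | exists (s : seq I) (B : I -> set V),
     [/\ {subset s <= J}, forall i, measurable (B i) &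
         A = [set w | forall i, i \in s -> B i (S i w)]]].

Lemma cylinders_measurable J : cylinders J `<=` measurable.
Proof.
move=> _ [s [B [_ mB ->]]].
have -> : [set w | forall i, i \in s -> B i (S i w)] =
    \big[setI/setT]_(i <- s) (S i @^-1` B i).
  by rewrite bigsetI_seq_forall.
by apply: bigsetI_measurable => i _; exact: measurable_funPTI.
Qed.

Lemma cylinders_setI_closed J : setI_closed (cylinders J).
Proof.
move=> _ _ [s [B [sJ mB ->]]] [t [C [tJ mC ->]]].
exists (s ++ t), (fun i => (if i \in s then B i else setT) `&`
                           (if i \in t then C i else setT)); split.
- by move=> i; rewrite mem_cat => /orP[/sJ|/tJ].
- by move=> i; apply: measurableI; case: ifP.
- apply/seteqP; split => w /=.
    by move=> [H1 H2] i; rewrite mem_cat; split; case: ifP => //; [exact: H1|exact: H2].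
  move=> H; split => i ii; have := H i; rewrite mem_cat ii ?orbT => /(_ isT)[].
    by [].
  by [].
Qed.

Lemma sigma_cylinders_measurable J A : <<s cylinders J >> A -> measurable A.
Proof.
apply: smallest_sub; first exact: sigma_algebra_measurable.
exact: cylinders_measurable.
Qed.

Lemma independent_sigma_cylinders J K : mutually_independent S ->
  (forall i, J i -> ~~ K i) -> forall A B,
  <<s cylinders J >> A -> <<s cylinders K >> B -> P (A `&` B) = (P A * P B)%E.
Proof.
move=> ind JK; apply: independent_pi_lambda.
- exact: cylinders_measurable.
- exact: cylinders_setI_closed.
- exact: cylinders_measurable.
- exact: cylinders_setI_closed.
move=> _ _ [s [B [sJ mB ->]]] [t [C [tK mC ->]]].
have bigE (r : seq I) (D : I -> set V) :
    [set w | forall i, i \in r -> D i (S i w)] =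
    \big[setI/setT]_(i <- undup r) (S i @^-1` D i).
  rewrite bigsetI_seq_forall; apply/seteqP; split => w /= H i.
    by rewrite mem_undup; exact: H.
  by rewrite -mem_undup; exact: H.
rewrite !bigE.
pose D i := if i \in s then B i else C i.
have Es : \big[setI/setT]_(i <- undup s) (S i @^-1` B i) =
          \big[setI/setT]_(i <- undup s) (S i @^-1` D i).
  by apply: eq_big_seq => i; rewrite mem_undup /D => ->.
have ts i : i \in t -> i \in s = false.
  by move=> /tK Ki; apply/negP => /sJ /JK /negP; apply; exact: Ki.
have Et : \big[setI/setT]_(i <- undup t) (S i @^-1` C i) =
          \big[setI/setT]_(i <- undup t) (S i @^-1` D i).
  by apply: eq_big_seq => i; rewrite mem_undup /D => /ts ->.
have mD i : measurable (D i) by rewrite /D; case: ifP.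
rewrite Es Et -big_cat !ind ?undup_uniq// ?big_cat//.
rewrite cat_uniq !undup_uniq andbT/=; apply/hasPn => i.
by rewrite !mem_undup => /ts ->.
Qed.

(** The space [W] with the sigma-algebra of the coordinates in [J].  The
    identity of [W] into this type is a random variable that carries all the
    information on these coordinates, without an infinite product space. *)
Definition coordinates_type J := g_sigma_algebraType (cylinders J).

Lemma coordinates_measurable J i : J i ->
  measurable_fun setT (S i : coordinates_type J -> V).
Proof.
move=> Ji _ B mB; rewrite setTI; apply: sub_sigma_algebra.
exists [:: i], (fun=> B); split => //.
  by move=> k; rewrite inE => /eqP ->.
apply/seteqP; split => w /=; last by apply; rewrite mem_head.
by move=> H k; rewrite inE => /eqP ->.
Qed.

End GeneratedByCoordinates.

(** * Maxima over the first generations *)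

Section SchemeMeasurability.
Context {R : realType}.

Lemma measurable_enum_atoms :
  measurable_fun setT (fun z : scheme R => enum_atoms z : atoms R).
Proof. exact: (measurableT_comp measurable_fst measurable_fst). Qed.

Lemma measurable_size_atoms :
  measurable_fun setT (fun z : scheme R => size (enum_atoms z)).
Proof.
suff ms : measurable_fun setT (fun s : atoms R => size s).
  exact: (measurableT_comp ms measurable_enum_atoms).
move=> _ B _; rewrite setTI.
have -> : (fun s : atoms R => size s) @^-1` B =
    \bigcup_(n in B) [set s : atoms R | size s = n].
  by apply/seteqP; split => [s Bs|s [n Bn /= ->]//]; exists (size s).
apply: bigcup_measurable => n _; apply: sub_sigma_algebra; left.
by exists n.
Qed.

Lemma measurable_nth_atoms j :
  measurable_fun setT (fun z : scheme R => nth 0 (enum_atoms z) j).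
Proof.
suff ms : measurable_fun setT (fun s : atoms R => nth 0 s j).
  exact: (measurableT_comp ms measurable_enum_atoms).
move=> _ B mB; rewrite setTI; apply: sub_sigma_algebra; right.
by exists j, B.
Qed.

Lemma measurable_Lam : measurable_fun setT (@Lam R).
Proof. exact: (measurableT_comp measurable_snd measurable_fst). Qed.

(** Functions of the atoms are defined by finite sums and products whose
    length is itself random. *)
Lemma measurable_fun_nat_index d (T : measurableType d) d' (V : measurableType d')
    (N : T -> nat) (F : nat -> T -> V) :
  measurable_fun setT N -> (forall n, measurable_fun setT (F n)) ->
  measurable_fun setT (fun x => F (N x) x).
Proof.
move=> mN mF _ B mB; rewrite setTI.
have -> : (fun x => F (N x) x) @^-1` B =
    \bigcup_n (N @^-1` [set n] `&` F n @^-1` B).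
  by apply/seteqP; split => [x Bx|x [n _ [/= <-]]//]; exists (N x).
apply: bigcup_measurable => n _; apply: measurableI.
  by rewrite -[X in measurable X]setTI; exact: mN.
by rewrite -[X in measurable X]setTI; exact: mF.
Qed.

Lemma measurable_sum_atoms (f : R -> R) : measurable_fun setT f ->
  measurable_fun setT (fun z : scheme R => \sum_(x <- enum_atoms z) f x).
Proof.
move=> mf; under eq_fun do rewrite (big_nth 0) big_mkord.
apply: (@measurable_fun_nat_index _ _ _ _ (fun z : scheme R => size (enum_atoms z))
  (fun n z => \sum_(i < n) f (nth 0 (enum_atoms z) i))).
  exact: measurable_size_atoms.
move=> n; apply: measurable_sum => i.
by apply: measurableT_comp => //; exact: measurable_nth_atoms.
Qed.

Lemma measurable_prod_atoms (f : R -> R) : measurable_fun setT f ->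
  measurable_fun setT (fun z : scheme R => \prod_(x <- enum_atoms z) f x).
Proof.
move=> mf; under eq_fun do rewrite (big_nth 0) big_mkord.
apply: (@measurable_fun_nat_index _ _ _ _ (fun z : scheme R => size (enum_atoms z))
  (fun n z => \prod_(i < n) f (nth 0 (enum_atoms z) i))).
  exact: measurable_size_atoms.
move=> n; apply: measurable_prod => i _.
by apply: measurableT_comp => //; exact: measurable_nth_atoms.
Qed.

End SchemeMeasurability.

Section MaxUpto.
Context {R : realType}.
Implicit Types (s : word -> scheme R) (v : word).

Definition subtree j s : word -> scheme R := fun u => s (j :: u).

Lemma in_tree_cons s j v : in_tree s (j :: v) =
  (j < size (enum_atoms (s [::])))%N && in_tree (subtree j s) v.
Proof.
elim/last_ind: v => [|v i IH].
  by rewrite -[[:: j]]/(rcons [::] j) in_tree_rcons !in_tree_nil andbT.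
by rewrite -rcons_cons !in_tree_rcons IH andbA.
Qed.

Lemma pos_cons s j v :
  pos s (j :: v) = nth 0 (enum_atoms (s [::])) j + pos (subtree j s) v.
Proof.
elim/last_ind: v => [|v i IH].
  by rewrite -[[:: j]]/(rcons [::] j) pos_rcons !pos_nil add0r addr0.
by rewrite -rcons_cons !pos_rcons IH addrA.
Qed.

Lemma Lam_at_cons s j v :
  Lam_at s (j :: v) = nth 0 (enum_atoms (s [::])) j + Lam_at (subtree j s) v.
Proof. by rewrite /Lam_at pos_cons addrA. Qed.

Definition max_upto n s : \bar R :=
  ereal_sup [set (Lam_at s v)%:E | v in [set v | in_tree s v && (size v < n)%N]].

Lemma max_upto_leP n s (t : R) : (max_upto n s <= t%:E)%E <->
  (forall v, in_tree s v -> (size v < n)%N -> Lam_at s v <= t).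
Proof.
split=> [H v Tv vn|H].
  rewrite -lee_fin; apply: le_trans H; apply: ereal_sup_ubound.
  by exists v => //=; rewrite Tv vn.
by apply: ge_ereal_sup => _ /= [v /andP[Tv vn] <-]; rewrite lee_fin H.
Qed.

Lemma max_upto0 s : max_upto 0 s = -oo%E.
Proof.
apply/eqP; rewrite eq_le leNye andbT.
by apply: ge_ereal_sup => x [v /=]; rewrite ltn0 andbF.
Qed.

(** The branching property, before taking probabilities. *)
Lemma max_upto_succ_leP n s (t : R) : (max_upto n.+1 s <= t%:E)%E <->
  Lam (s [::]) <= t /\
  forall j, (j < size (enum_atoms (s [::])))%N ->
    (max_upto n (subtree j s) <= (t - nth 0 (enum_atoms (s [::])) j)%:E)%E.
Proof.
rewrite max_upto_leP; split.
  move=> H; split.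
    by have := H [::]; rewrite in_tree_nil /Lam_at pos_nil add0r; apply.
  move=> j jN; apply/max_upto_leP => v Tv vn.
  by rewrite lerBrDl -Lam_at_cons; apply: H => //; rewrite in_tree_cons jN.
move=> [H0 H] [|j v].
  by move=> _ _; rewrite /Lam_at pos_nil add0r.
rewrite in_tree_cons => /andP[jN Tv]; rewrite ltnS => vn.
rewrite Lam_at_cons -lerBrDl.
by have /max_upto_leP := H j jN; apply.
Qed.

Lemma sup_Lam_leP s (t : R) : (sup_Lam s <= t%:E)%E <->
  forall n, (max_upto n s <= t%:E)%E.
Proof.
split=> [H n|H].
  apply: le_trans H; apply: ge_ereal_sup => _ [v /andP[Tv _] <-].
  by apply: ereal_sup_ubound; exists v.
apply: ge_ereal_sup => _ [v Tv <-].
by rewrite lee_fin; have /max_upto_leP := H (size v).+1; apply.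
Qed.

Lemma max_upto_le_succ n s : (max_upto n s <= max_upto n.+1 s)%E.
Proof.
apply: ge_ereal_sup => _ [v /andP[Tv vn] <-]; apply: ereal_sup_ubound.
by exists v => //=; rewrite Tv ltnW.
Qed.

Section Measurability.
Context d (T : measurableType d) (S : T -> word -> scheme R).
Hypothesis mS : forall u, measurable_fun setT (S^~ u).

Lemma measurable_in_tree v : measurable_fun setT (fun w => in_tree (S w) v).
Proof.
elim/last_ind: v => [|v j IH].
  by under eq_fun do rewrite in_tree_nil; exact: measurable_cst.
under eq_fun do rewrite in_tree_rcons.
apply: measurable_and => //.
have mj : measurable_fun setT (fun n : nat => (j < n)%N) by [].
exact: (measurableT_comp mj (measurableT_comp measurable_size_atoms (mS v))).
Qed.

Lemma measurable_pos v : measurable_fun setT (fun w => pos (S w) v).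
Proof.
elim/last_ind: v => [|v j IH].
  by under eq_fun do rewrite pos_nil; exact: measurable_cst.
under eq_fun do rewrite pos_rcons.
apply: measurable_funD => //.
exact: (measurableT_comp (measurable_nth_atoms j) (mS v)).
Qed.

(** A countable supremum over words; the words outside the random tree
    contribute [-oo]. *)
Lemma measurable_max_upto n : measurable_fun setT (fun w => max_upto n (S w)).
Proof.
pose h k w : \bar R := if @unpickle word k is Some v then
  if in_tree (S w) v && (size v < n)%N then (Lam_at (S w) v)%:E else -oo%E
  else -oo%E.
have -> : (fun w => max_upto n (S w)) = (fun w => esups (h^~ w) 0).
  apply/funext => w; rewrite /esups /sdrop; apply/eqP; rewrite eq_le; apply/andP; split.
    apply: ge_ereal_sup => _ [v /= Tv <-]; apply: ereal_sup_ubound.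
    by exists (pickle v) => //; rewrite /h pickleK Tv.
  apply: ge_ereal_sup => _ [k /= _ <-]; rewrite /h.
  case: unpickle => [v|]; last exact: leNye.
  case: ifP => Tv; last exact: leNye.
  by apply: ereal_sup_ubound; exists v.
apply: measurable_fun_esups => k; rewrite /h.
case: unpickle => [v|]; last exact: measurable_cst.
apply: measurable_fun_ifT => //.
- by apply: measurable_and => //; exact: measurable_in_tree.
- apply/measurable_EFinP; apply: measurable_funD; first exact: measurable_pos.
  exact: (measurableT_comp measurable_Lam (mS v)).
Qed.

End Measurability.
End MaxUpto.

(** * Recursive equation for the law of the maxima *)

Section Stay.
Context {R : realType}.

(** The conditional probability, given the value [z] at the root, that no
    individual exceeds [t], when [g] is the corresponding probability for each
    of the subtrees. *)
Definition below (g : R -> R) (t : R) (z : scheme R) : R :=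
  (Lam z <= t)%R%:R * \prod_(x <- enum_atoms z) g (t - x).

Lemma measurable_below g t : measurable_fun setT g ->
  measurable_fun setT (below g t).
Proof.
move=> mg; apply: measurable_funM.
  have mb : measurable_fun setT (fun b : bool => b%:R : R) by [].
  apply: (measurableT_comp mb); apply: measurable_fun_ler => //.
  exact: measurable_Lam.
apply: measurable_prod_atoms; apply: measurableT_comp => //.
exact: measurable_funB.
Qed.

Lemma below_unit_interval g t z : (forall x, 0 <= g x <= 1) ->
  0 <= below g t z <= 1.
Proof.
move=> g01; rewrite /below; case: (Lam z <= t); last by rewrite mul0r lexx ler01.
by rewrite mul1r; apply: prod_unit_interval.
Qed.

Lemma below_le g t t' z : (forall x, 0 <= g x <= 1) -> {homo g : x y / x <= y} ->
  t <= t' -> below g t z <= below g t' z.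
Proof.
move=> g01 g_nd tt'; apply: ler_pM => //.
- by have /andP[] := @prod_unit_interval R _ (enum_atoms z) (fun x => g (t - x)) (fun x _ => g01 _).
- rewrite ler_nat; case: leP => // Lt; by rewrite (le_trans Lt tt').
- apply: ler_prod => x _; have /andP[-> _] := g01 (t - x).
  by rewrite g_nd// lerB.
Qed.

(** One quantity controlling at the same time the number of atoms, their
    positions and [Lam], so that a single truncation serves everywhere. *)
Definition extent (z : scheme R) : R :=
  (size (enum_atoms z))%:R + `|Lam z| + \sum_(x <- enum_atoms z) `|x|.

Lemma measurable_extent : measurable_fun setT extent.
Proof.
apply: measurable_funD.
  apply: measurable_funD.
    have mn : measurable_fun setT (fun n : nat => n%:R : R) by [].
    exact: (measurableT_comp mn measurable_size_atoms).
  exact: (measurableT_comp (@normr_measurable R setT) measurable_Lam).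
exact: (measurable_sum_atoms (@normr_measurable R setT)).
Qed.

Lemma extent_leP z (K : R) : extent z <= K ->
  [/\ (size (enum_atoms z))%:R <= K, Lam z <= K &
      forall x, x \in enum_atoms z -> `|x| <= K].
Proof.
have N0 : 0 <= (size (enum_atoms z))%:R :> R by rewrite ler0n.
have L0 := normr_ge0 (Lam z).
have X0 : 0 <= \sum_(x <- enum_atoms z) `|x| by apply: sumr_ge0.
rewrite /extent => EK; split; first by lra.
  by have := ler_norm (Lam z); lra.
move=> x xS; apply: (@le_trans _ _ (\sum_(y <- enum_atoms z) `|y|)); last by lra.
by rewrite (big_rem x)//= lerDl sumr_ge0.
Qed.

Context {d0} {W0 : measurableType d0} {P0 : probability W0 R} (S0 : {RV P0 >-> scheme R}).

(** It depends on the reproduction law only; [law_max_upto] identifies it with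
    the distribution function of [max_upto n]. *)
Fixpoint stay n (t : R) : R :=
  if n is n'.+1 then \int[P0]_w below (stay n') t (S0 w) else 1.

(** Measurability, which the integral defining the next function requires,
    comes from monotonicity. *)
Lemma stay_spec n : [/\ {homo stay n : x y / x <= y}, forall t, 0 <= stay n t <= 1
  & measurable_fun setT (stay n)].
Proof.
elim: n => [|n [nd s01 ms]].
  by split => //= t; rewrite ler01 lexx.
have mb t : measurable_fun setT (fun w => below (stay n) t (S0 w)).
  exact: (measurableT_comp (measurable_below t ms)).
have b01 t w : 0 <= below (stay n) t (S0 w) <= 1 by exact: below_unit_interval.
have nd1 : {homo stay n.+1 : x y / x <= y}.
  move=> x y xy /=; apply: le_Rintegral => //; try exact: integrable_unit_interval.
  by move=> w _; exact: below_le.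
split => //; first by move=> t; exact: Rintegral_unit_interval.
exact: nondecreasing_measurable.
Qed.

Lemma stay_unit_interval n t : 0 <= stay n t <= 1.
Proof. by have [] := stay_spec n. Qed.

Lemma stay_measurable n : measurable_fun setT (stay n).
Proof. by have [] := stay_spec n. Qed.

End Stay.

Section Law.
Context {R : realType} {d0} {W0 : measurableType d0} {P0 : probability W0 R}
  (S0 : {RV P0 >-> scheme R}) {d} {W : measurableType d} {P : probability W R}.
Implicit Types S : word -> {RV P >-> scheme R}.

Lemma iid_copies_subtree S j : iid_copies S0 S ->
  iid_copies S0 (fun u => S (j :: u)).
Proof.
move=> [ind dS]; split => [J A uJ mA|i A mA]; last exact: dS.
have inj : injective (cons j : word -> word) by move=> u v [].
have := ind (map (cons j) J) (A \o behead).
rewrite !big_map map_inj_uniq//; apply => // i.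
exact: mA.
Qed.

Lemma Rintegral_root S (f : scheme R -> R) : iid_copies S0 S ->
  measurable_fun setT f -> (forall z, 0 <= f z) ->
  \int[P]_w f (S [::] w) = \int[P0]_w f (S0 w).
Proof.
move=> [_ dS] mf f0; congr fine.
transitivity (\int[distribution P (S [::])]_z (f z)%:E)%E.
  by rewrite ge0_integral_distribution//; exact/measurable_EFinP.
transitivity (\int[distribution P0 S0]_z (f z)%:E)%E.
  by apply: eq_measure_integral => A mA _; exact: dS.
by rewrite ge0_integral_distribution//; exact/measurable_EFinP.
Qed.

Section RootStep.
Variables (S : word -> {RV P >-> scheme R}) (n : nat) (t : R).
Hypothesis iidS : iid_copies S0 S.
Hypothesis IH : forall j (y : R),
  P [set w | (max_upto n (subtree j (S^~ w)) <= y%:E)%E] = (stay S0 n y)%:E.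

Let M j w := max_upto n (subtree j (S^~ w)).

Let Y j (z : scheme R) : \bar R :=
  if (j < size (enum_atoms z))%N then (t - nth 0 (enum_atoms z) j)%:E else +oo%E.

Let G j (z : scheme R) : R :=
  if (j < size (enum_atoms z))%N then stay S0 n (t - nth 0 (enum_atoms z) j) else 1.

Let measurable_lt_size j :
  measurable_fun setT (fun z : scheme R => (j < size (enum_atoms z))%N).
Proof.
have mj : measurable_fun setT (fun m : nat => (j < m)%N) by [].
exact: (measurableT_comp mj measurable_size_atoms).
Qed.

Let measurable_Y j : measurable_fun setT (Y j).
Proof.
apply: measurable_fun_ifT => //; apply/measurable_EFinP.
by apply: measurable_funB => //; exact: measurable_nth_atoms.
Qed.

Let measurable_G j : measurable_fun setT (G j).
Proof.
apply: measurable_fun_ifT => //.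
apply: measurableT_comp; first exact: stay_measurable.
by apply: measurable_funB => //; exact: measurable_nth_atoms.
Qed.

Let G_unit j z : 0 <= G j z <= 1.
Proof.
by rewrite /G; case: ifP => _; [exact: stay_unit_interval|rewrite ler01 lexx].
Qed.

Let measurable_bool_to_R : measurable_fun setT (fun b : bool => b%:R : R).
Proof. by []. Qed.

Let past k : pred word := fun v => if v is j :: _ then (j < k)%N else true.

Let branch k : pred word := fun v => if v is j :: _ then j == k else false.

Let coordinates_id (J : pred word) : W -> coordinates_type S J := idfun.

Let coordinates_id_measurable J : measurable_fun setT (coordinates_id J).
Proof. by move=> _ A mA; rewrite setTI; exact: (sigma_cylinders_measurable mA). Qed.

(** The subtrees are integrated out one at a time, the last one first: given
    the root and the other subtrees, its contribution is [G k].  A general weight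
    [f] of the root absorbs the factors already computed. *)
Let integral_branches k (f : scheme R -> R) :
  measurable_fun setT f -> (forall z, 0 <= f z) ->
  (\int[P]_w (f (S [::] w) * \prod_(j < k) (M j w <= Y j (S [::] w))%E%:R)%:E =
   \int[P]_w (f (S [::] w) * \prod_(j < k) G j (S [::] w))%:E)%E.
Proof.
elim: k f => [|k IHk] f mf f0.
  by apply: eq_integral => w _; rewrite !big_ord0.
pose X1 : {RV P >-> coordinates_type S (past k)} := HB.pack (coordinates_id (past k))
  (isMeasurableFun.Build _ _ _ _ _ (@coordinates_id_measurable (past k))).
pose X2 : {RV P >-> coordinates_type S (branch k)} := HB.pack (coordinates_id (branch k))
  (isMeasurableFun.Build _ _ _ _ _ (@coordinates_id_measurable (branch k))).
pose h w : R := f (S [::] w) * \prod_(j < k) (M j w <= Y j (S [::] w))%E%:R.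
have h0 w : 0 <= h w by rewrite mulr_ge0// prodr_ge0// => j _; rewrite ler0n.
have mS0 : measurable_fun setT (S [::] : coordinates_type S (past k) -> scheme R).
  exact: coordinates_measurable.
have mh : measurable_fun setT (h : coordinates_type S (past k) -> R).
  apply: measurable_funM; first exact: (measurableT_comp mf mS0).
  apply: measurable_prod => j _; apply: (measurableT_comp measurable_bool_to_R).
  apply: measurable_fun_lee; last exact: (measurableT_comp (measurable_Y j) mS0).
  apply: (@measurable_max_upto _ _ (coordinates_type S (past k))
    (fun w => subtree j (S^~ w))) => u.
  apply: coordinates_measurable; exact: ltn_ord.
have mM : measurable_fun setT (M k : coordinates_type S (branch k) -> \bar R).
  apply: (@measurable_max_upto _ _ (coordinates_type S (branch k))
    (fun w => subtree k (S^~ w))) => u.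
  by apply: coordinates_measurable; exact: eqxx.
pose F (z : coordinates_type S (past k) * coordinates_type S (branch k)) : \bar R :=
  (h z.1 * (M k z.2 <= Y k (S [::] z.1))%E%:R)%:E.
have mF : measurable_fun setT F.
  apply/measurable_EFinP; apply: measurable_funM.
    exact: (measurableT_comp mh measurable_fst).
  apply: (measurableT_comp measurable_bool_to_R); apply: measurable_fun_lee.
    exact: (measurableT_comp mM measurable_snd).
  exact: (measurableT_comp (measurable_Y k) (measurableT_comp mS0 measurable_fst)).
transitivity (\int[P]_w F (X1 w, X2 w))%E.
  by apply: eq_integral => w _; rewrite big_ord_recr /= mulrA.
rewrite (ge0_integral_independent (X1 := X1) (X2 := X2))//; last 2 first.
- move=> A B mA mB; apply: (independent_sigma_cylinders (iidS.1) _ mA mB).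
  by move=> [|i v]//=; rewrite neq_ltn => ->.
- by move=> z; rewrite lee_fin mulr_ge0// ler0n.
transitivity (\int[P]_w (f (S [::] w) * G k (S [::] w) *
    \prod_(j < k) (M j w <= Y j (S [::] w))%E%:R)%:E)%E; last first.
  rewrite (IHk (fun z => f z * G k z)).
  - apply: eq_integral => w _; rewrite big_ord_recr /=; congr EFin; ring.
  - exact: measurable_funM.
  - by move=> z; rewrite mulr_ge0//; have /andP[] := G_unit k z.
apply: eq_integral => w _; rewrite /F/=.
transitivity ((h w)%:E * \int[P]_w' ((M k w' <= Y k (S [::] w))%E%:R)%:E)%E.
  under eq_integral do rewrite EFinM.
  rewrite ge0_integralZl//.
  - apply/measurable_EFinP; apply: (measurableT_comp measurable_bool_to_R).
    apply: measurable_fun_lee => //.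
    apply: (@measurable_max_upto _ _ W (fun w => subtree k (S^~ w))) => u.
    exact: measurable_funPT.
  - by rewrite lee_fin.
suff -> : (\int[P]_w' ((M k w' <= Y k (S [::] w))%E%:R)%:E = (G k (S [::] w))%:E)%E.
  by rewrite -EFinM /h; congr EFin; ring.
rewrite /Y /G; case: ifP => _.
  rewrite -(IH k); set A := [set w | _].
  transitivity (\int[P]_w' (\1_A w')%:E)%E.
    apply: eq_integral => w' _; rewrite indicE; congr (nat_of_bool _)%:R%:E.
    by apply/idP/idP => [?|/set_mem//]; exact/mem_set.
  rewrite integral_indic ?setIT//.
  have mMW : measurable_fun setT (fun w => max_upto n (subtree k (S^~ w))).
    apply: (@measurable_max_upto _ _ W (fun w => subtree k (S^~ w))) => u.
    exact: measurable_funPT.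
  by rewrite /A -[X in measurable X]setTI; exact: measurable_lee.
under eq_integral do rewrite leey.
transitivity (1%:E * P setT)%E; first exact: integral_cst.
by rewrite probability_setT mule1.
Qed.

(** The number of subtrees is random, so that [integral_branches] is used for
    the first [k] subtrees and [k] tends to infinity; the integrands are
    eventually constant. *)
Lemma law_max_upto_step :
  P [set w | (max_upto n.+1 (S^~ w) <= t%:E)%E] = (stay S0 n.+1 t)%:E.
Proof.
pose f (z : scheme R) : R := (Lam z <= t)%R%:R.
have f0 z : 0 <= f z by rewrite ler0n.
have mf : measurable_fun setT f.
  apply: (measurableT_comp measurable_bool_to_R); apply: measurable_fun_ler => //.
  exact: measurable_Lam.
have mSW u : measurable_fun setT (S u) by exact: measurable_funPT.
have mMW k : measurable_fun setT (M k).
  exact: (@measurable_max_upto _ _ W (fun w => subtree k (S^~ w))).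
pose A := [set w | (max_upto n.+1 (S^~ w) <= t%:E)%E].
have mA : measurable A.
  rewrite /A -[X in measurable X]setTI; apply: measurable_lee => //.
  exact: (@measurable_max_upto _ _ W (fun w => S^~ w)).
pose F k w : R := f (S [::] w) * \prod_(j < k) (M j w <= Y j (S [::] w))%E%:R.
pose H k w : R := f (S [::] w) * \prod_(j < k) G j (S [::] w).
have FH k : \int[P]_w F k w = \int[P]_w H k w by congr fine; exact: integral_branches.
have unit_prod (a : R) k (b : nat -> R) : 0 <= a <= 1 -> (forall j, 0 <= b j <= 1) ->
    0 <= a * \prod_(j < k) b j <= 1.
  move=> /andP[a0 a1] b01; have /andP[p0 p1] : 0 <= \prod_(j < k) b j <= 1.
    by apply: prod_unit_interval => j _.
  by rewrite mulr_ge0//= mulr_ile1.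
have bool_unit (b : bool) : 0 <= (b%:R : R) <= 1 by case: b; rewrite lexx ler01.
have cvgF : (fun k => \int[P]_w F k w) @ \oo --> \int[P]_w (\1_A w : R).
  apply: (@cvg_Rintegral_stationary _ _ _ P F _ (cst 1)).
  - move=> k; apply: measurable_funM; first exact: (measurableT_comp mf (mSW _)).
    apply: measurable_prod => j _; apply: (measurableT_comp measurable_bool_to_R).
    by apply: measurable_fun_lee => //; exact: (measurableT_comp (measurable_Y j) (mSW _)).
  - exact: finite_measure_integrable_cst.
  - move=> k w; have /andP[F0 F1] := unit_prod (f (S [::] w)) k
      (fun j => (M j w <= Y j (S [::] w))%E%:R) (bool_unit _) (fun j => bool_unit _).
    by rewrite ger0_norm.
  - move=> w; exists (size (enum_atoms (S [::] w))) => k Nk.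
    rewrite indicE; have [/set_mem/max_upto_succ_leP[L0 L1]|] := boolP (w \in A).
      rewrite /F /f L0 mul1r big1// => j _; rewrite /Y.
      by case: ifP => jN; [rewrite (L1 j jN)|rewrite leey].
    rewrite notin_setE => nA; rewrite /F /f; case: (leP _ t) => L0; last by rewrite mul0r.
    rewrite mul1r; apply/eqP; rewrite prodf_seq_eq0; apply/hasP.
    apply: contrapT => all1; apply: nA; apply/max_upto_succ_leP; split => // j jN.
    rewrite leNgt; apply/negP => lt1; apply: all1.
    exists (Ordinal (leq_trans jN Nk)); first by rewrite mem_index_enum.
    by rewrite /= /Y jN /M leNgt lt1.
have cvgH : (fun k => \int[P]_w H k w) @ \oo -->
    \int[P]_w below (stay S0 n) t (S [::] w).
  apply: (@cvg_Rintegral_stationary _ _ _ P H _ (cst 1)).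
  - move=> k; apply: measurable_funM; first exact: (measurableT_comp mf (mSW _)).
    by apply: measurable_prod => j _; exact: (measurableT_comp (measurable_G j) (mSW _)).
  - exact: finite_measure_integrable_cst.
  - move=> k w; have /andP[H0 H1] := unit_prod (f (S [::] w)) k
      (fun j => G j (S [::] w)) (bool_unit _) (fun j => G_unit _ _).
    by rewrite ger0_norm.
  - move=> w; exists (size (enum_atoms (S [::] w))) => k Nk.
    rewrite /H /below /f; congr (_ * _).
    rewrite (big_nth 0) -(big_mkord predT (fun j => G j (S [::] w))).
    rewrite (big_cat_nat _ Nk)//= [X in _ * X]big_nat_cond [X in _ * X]big1 ?mulr1.
      by apply: eq_big_nat => j /andP[_ jN]; rewrite /G jN.
    by move=> j /andP[/andP[Nj _] _]; rewrite /G ltnNge Nj.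
have E : \int[P]_w (\1_A w : R) = \int[P]_w below (stay S0 n) t (S [::] w).
  rewrite -(cvg_lim (@Rhausdorff R) cvgF) -(cvg_lim (@Rhausdorff R) cvgH).
  by congr (lim (_ @ \oo)); apply/funext => k; exact: FH.
rewrite -/A -(fineK (fin_num_measure P _ mA)) -Rintegral_indicator// E/=.
rewrite (Rintegral_root (f := below (stay S0 n) t) iidS)//.
- by apply: measurable_below; exact: stay_measurable.
- by move=> z; have /andP[] := @below_unit_interval _ (stay S0 n) t z (stay_unit_interval S0 n).
Qed.

End RootStep.

Lemma law_max_upto S n (t : R) : iid_copies S0 S ->
  P [set w | (max_upto n (S^~ w) <= t%:E)%E] = (stay S0 n t)%:E.
Proof.
elim: n S t => [|n IH] S t iidS.
  rewrite (_ : [set w | _] = setT) ?probability_setT//.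
  by apply/seteqP; split => w //= _; rewrite max_upto0 leNye.
apply: law_max_upto_step => // j y.
exact: (IH (fun u => S (j :: u)) y (iid_copies_subtree j iidS)).
Qed.

Let measurable_max_upto_le S n (t : R) :
  measurable [set w | (max_upto n (S^~ w) <= t%:E)%E].
Proof.
rewrite -[X in measurable X]setTI; apply: measurable_lee => //.
apply: (@measurable_max_upto _ _ W (fun w => S^~ w)) => u.
exact: measurable_funPT.
Qed.

Lemma sup_Lam_gtE S (t : R) :
  [set w | (t%:E < sup_Lam (S^~ w))%E] =
  ~` \bigcap_n [set w | (max_upto n (S^~ w) <= t%:E)%E].
Proof.
apply/seteqP; split => w /=.
  rewrite ltNge => /negP H1 H2; apply: H1; apply/sup_Lam_leP => n; exact: H2.
by move=> H; rewrite ltNge; apply/negP => /sup_Lam_leP H2; apply: H => n _ /=.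
Qed.

Lemma tail_ge_stay S n (t : R) : iid_copies S0 S ->
  1 - stay S0 n t <= fine (P [set w | (t%:E < sup_Lam (S^~ w))%E]).
Proof.
move=> iidS; have mI := bigcap_measurableType (fun n _ => measurable_max_upto_le S n t).
rewrite -lee_fin fineK ?fin_num_measure ?sup_Lam_gtE//; last exact: measurableC.
rewrite EFinB -(law_max_upto n t iidS) -probability_setC//.
apply: le_measure; rewrite ?inE//; try exact: measurableC.
by apply: subsetC => w; apply.
Qed.

Lemma tail_le_stay S (t x : R) : iid_copies S0 S ->
  (forall n, 1 - stay S0 n t <= x) ->
  fine (P [set w | (t%:E < sup_Lam (S^~ w))%E]) <= x.
Proof.
move=> iidS stayx.
have mI := bigcap_measurableType (fun n _ => measurable_max_upto_le S n t).
rewrite -lee_fin fineK ?fin_num_measure ?sup_Lam_gtE//; last exact: measurableC.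
rewrite setC_bigcap.
have cv : P \o (fun n => ~` [set w | (max_upto n (S^~ w) <= t%:E)%E]) @ \oo -->
    P (\bigcup_n ~` [set w | (max_upto n (S^~ w) <= t%:E)%E]).
  apply: nondecreasing_cvg_mu.
  - by move=> n; exact: measurableC.
  - by apply: bigcupT_measurable => n; exact: measurableC.
  - apply/nondecreasing_seqP => n; apply/subsetPset; apply: subsetC => w /=.
    exact: le_trans (max_upto_le_succ _ _).
rewrite -(cvg_lim _ cv)//; apply: lime_le; first by apply/cvg_ex; eexists; exact: cv.
apply: nearW => n /=; rewrite probability_setC// (law_max_upto n t iidS).
by rewrite -EFinB lee_fin.
Qed.

End Law.

(** * Moments of the reproduction law *)

Section ChiIntegrals.
Context {R : realType}.
Implicit Types z : scheme R.

Lemma chi_setT z : chi z setT = (size (enum_atoms z))%:R%:E.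
Proof.
rewrite /chi /= /msum (eq_bigr (fun=> 1%:E)) => [|i _]; last by have := diracE R ((enum_atoms z)`_i) setT; rewrite in_setT.
by rewrite sumEFin big_const_ord iter_addr_0.
Qed.

Lemma ge0_integral_chi z (f : R -> R) : measurable_fun setT f ->
  (forall x, 0 <= f x) ->
  (\int[chi z]_x (f x)%:E = (\sum_(x <- enum_atoms z) f x)%:E)%E.
Proof.
move=> mf f0; rewrite /chi ge0_integral_measure_sum//; last 2 first.
  by move=> x _; rewrite lee_fin.
  exact/measurable_EFinP.
rewrite (big_nth 0) big_mkord -sumEFin; apply: eq_bigr => i _.
rewrite integral_dirac//; last exact/measurable_EFinP.
by have := diracE R ((enum_atoms z)`_i) setT; rewrite in_setT => ->; rewrite mul1e.
Qed.

Lemma integral_chi_id z :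
  (\int[chi z]_x x%:E = (\sum_(x <- enum_atoms z) x)%:E)%E.
Proof.
rewrite integralE.
have -> : (\int[chi z]_x (fun y : R => y%:E)^\+ x =
    \int[chi z]_x (Num.max x 0)%:E)%E.
  by apply: eq_integral => x _; rewrite funeposE EFin_max.
have -> : (\int[chi z]_x (fun y : R => y%:E)^\- x =
    \int[chi z]_x (Num.max (- x) 0)%:E)%E.
  by apply: eq_integral => x _; rewrite funenegE EFin_max.
rewrite !ge0_integral_chi//; last 4 first.
- by apply: measurable_maxr => //; exact: measurable_funN.
- by move=> x; rewrite le_max lexx orbT.
- exact: measurable_maxr.
- by move=> x; rewrite le_max lexx orbT.
rewrite -EFinB -sumrB; congr EFin; apply: eq_bigr => x _.
case: (lerP x 0) => x0; first by rewrite max_l ?oppr_ge0//; lra.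
by rewrite max_r; lra.
Qed.

(** Every atom has mass at least [1]. *)
Lemma support_chi z x : x \in enum_atoms z -> Defs.support (chi z) x.
Proof.
move=> /(nthP 0)[i iN <-] U _ Ux; rewrite /chi /= /msum.
rewrite (bigD1 (Ordinal iN))//=.
have := diracE R ((enum_atoms z)`_i) U; rewrite mem_set// => ->.
by rewrite (@lt_le_trans _ _ 1%:E) ?lte01// leeDl// sume_ge0.
Qed.

Lemma sup_measure_chi_ge z x : x \in enum_atoms z ->
  (x%:E <= sup_measure (chi z))%E.
Proof.
by move=> xz; apply: ereal_sup_ubound; exists x => //; exact: support_chi.
Qed.

End ChiIntegrals.

Section Moments.
Context {R : realType} {d0} {W0 : measurableType d0} {P0 : probability W0 R}
  (S0 : {RV P0 >-> scheme R}).

Definition mass w : R := (size (enum_atoms (S0 w)))%:R.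

Definition moment k w : R := \sum_(x <- enum_atoms (S0 w)) x ^+ k.

Let measurable_S0 : measurable_fun setT S0.
Proof. exact: measurable_funPT. Qed.

Lemma measurable_mass : measurable_fun setT mass.
Proof.
have mn : measurable_fun setT (fun n : nat => n%:R : R) by [].
exact: (measurableT_comp mn (measurableT_comp measurable_size_atoms measurable_S0)).
Qed.

Lemma measurable_moment k : measurable_fun setT (moment k).
Proof.
exact: (measurableT_comp (measurable_sum_atoms (exprn_measurable k)) measurable_S0).
Qed.

Lemma has_mean_of_integral (f : W0 -> R) (c : R) :
  measurable_fun setT f -> (forall w, 0 <= f w) ->
  (\int[P0]_w (f w)%:E = c%:E)%E ->
  has_mean P0 f c.
Proof.
move=> mf f0 fc; split; last by rewrite /Rintegral fc.
apply/integrableP; split; first exact/measurable_EFinP.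
under eq_integral do rewrite /= ger0_norm//.
by rewrite fc ltry.
Qed.

Lemma has_mean_mass : (\int[P0]_w chi (S0 w) [set: R] = 1)%E ->
  has_mean P0 mass 1.
Proof.
move=> H; apply: has_mean_of_integral; first exact: measurable_mass.
  by move=> w; rewrite ler0n.
by rewrite -[RHS]H; apply: eq_integral => w _; rewrite chi_setT.
Qed.

Lemma has_mean_mass_sqr (v : R) :
  (\int[P0]_w (chi (S0 w) [set: R] ^+ 2) = v%:E)%E ->
  has_mean P0 (fun w => mass w ^+ 2) v.
Proof.
move=> H; apply: has_mean_of_integral.
- by apply: measurable_funX; exact: measurable_mass.
- by move=> w; rewrite sqr_ge0.
- by rewrite -[RHS]H; apply: eq_integral => w _; rewrite chi_setT.
Qed.

Lemma has_mean_moment2 (v : R) :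
  (\int[P0]_w \int[chi (S0 w)]_x (x ^+ 2)%:E = v%:E)%E ->
  has_mean P0 (moment 2) v.
Proof.
move=> H; apply: has_mean_of_integral; first exact: measurable_moment.
  by move=> w; apply: sumr_ge0 => x _; rewrite sqr_ge0.
rewrite -[RHS]H; apply: eq_integral => w _; rewrite ge0_integral_chi//.
by move=> x; rewrite sqr_ge0.
Qed.

Lemma norm_moment1_le w : `|moment 1 w| <= mass w + moment 2 w.
Proof.
rewrite /mass -sum1_size natr_sum -big_split /=.
apply: le_trans (ler_norm_sum _ _ _) _; apply: ler_sum => x _; rewrite expr1.
by rewrite ler_norml; apply/andP; split; nra.
Qed.

Lemma has_mean_moment1 : P0.-integrable setT (EFin \o mass) ->
  P0.-integrable setT (EFin \o moment 2) ->
  (\int[P0]_w \int[chi (S0 w)]_x x%:E = 0)%E ->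
  has_mean P0 (moment 1) 0.
Proof.
move=> iN iX2 H; split.
  apply: (le_integrable _ _ _ (integrableD measurableT iN iX2)) => //.
    by apply/measurable_EFinP; exact: measurable_moment.
  move=> w _ /=; rewrite lee_fin (le_trans (norm_moment1_le w))//.
  exact: ler_norm.
rewrite /Rintegral -[RHS]/(fine 0%E) -H; congr fine.
by apply: eq_integral => w _; rewrite integral_chi_id.
Qed.

Lemma has_mean_Lam_gt (r : R) : has_mean P0 (fun w => (r < Lam (S0 w))%R%:R)
  (fine (P0 [set w | r < Lam (S0 w)])).
Proof.
have mb : measurable_fun setT (fun b : bool => b%:R : R) by [].
have mL : measurable_fun setT (fun w => Lam (S0 w)) :=
  measurableT_comp measurable_Lam measurable_S0.
have mlt : measurable_fun setT (fun w => r < Lam (S0 w)).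
  exact: measurable_fun_ltr.
have mA : measurable [set w | r < Lam (S0 w)].
  have := mlt measurableT [set true] I; rewrite setTI.
  by congr measurable; apply/seteqP; split => w /=.
rewrite -Rintegral_indicator//.
have -> : \int[P0]_w \1_[set w | r < Lam (S0 w)] w =
    \int[P0]_w ((r < Lam (S0 w))%R%:R : R).
  apply: eq_Rintegral => w _; rewrite indicE; congr (nat_of_bool _)%:R.
  by apply/idP/idP => [/set_mem//|?]; exact/mem_set.
apply: has_mean_unit_interval; first exact: (measurableT_comp mb mlt).
by move=> w; case: (_ < _); rewrite lexx ler01.
Qed.

Lemma ae_atoms_le_Lam : reproduction_scheme S0 ->
  {ae P0, forall w, 0 <= Lam (S0 w) /\
    forall x, x \in enum_atoms (S0 w) -> x <= Lam (S0 w)}.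
Proof.
move=> [L0 Lsup _]; apply: filterS2 L0 Lsup => w w0 wsup; split => // x xS.
by rewrite -lee_fin (le_trans _ wsup)//; exact: sup_measure_chi_ge.
Qed.

End Moments.

(** * Comparison with inverse squares *)

Section Pointwise.
Context {R : realType}.
Implicit Types (g : R -> R) (z : scheme R) (c e K q s t y : R).

(** When [Lam > e * y], the indicator alone is at least the left-hand side and
    the rest is nonnegative: the sum by [taylor_ge0], and the truncated
    quadratic term vanishes since [K <= e * y]. *)
Lemma onem_below_le g z t y e c K a : a = c / ((1 + e) * y) ^+ 2 ->
  (forall x, 0 <= g x <= 1) -> (forall x, x \in enum_atoms z -> x <= Lam z) ->
  0 <= c -> 0 < e <= 1 / 2 -> 0 < y <= t -> c <= ((1 - e) * y) ^+ 2 ->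
  K <= e * y -> K * a <= 1 ->
  (forall s, (1 - e) * y <= s -> 1 - c / s ^+ 2 <= g (t - y + s)) ->
  1 - below g t z <= (e * y < Lam z)%R%:R +
    \sum_(x <- enum_atoms z) taylor c (3 / (1 - e) ^+ 2) y x -
    (1 - K * a) * (a ^+ 2 / 2) *
      (((size (enum_atoms z))%:R ^+ 2 - (size (enum_atoms z))%:R) -
       (K < extent z)%R%:R * ((size (enum_atoms z))%:R ^+ 2 - (size (enum_atoms z))%:R)).
Proof.
move=> aE g01 xL c0 /andP[e0 e1] /andP[y0 yt] cy Key Ka Hg.
have T0 : 0 <= \sum_(x <- enum_atoms z) taylor c (3 / (1 - e) ^+ 2) y x.
  apply: sumr_ge0 => x _; apply: taylor_ge0 => //.
  rewrite ler_pdivlMr ?exprn_gt0//; last by lra.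
  by nra.
have /andP[b0 b1] := below_unit_interval t z g01.
have large : (K < extent z)%R%:R = 1 :> R \/
    (K < extent z)%R%:R = 0 :> R /\ extent z <= K.
  by case: ltP => EK; [left|right].
have [yLam|Lamy] := ltP (e * y) (Lam z).
  case: large => [->|[_ /extent_leP[_ LK _]]]; last by lra.
  by rewrite mul1r subrr mulr0 /= mulr1n; lra.
have Lt : Lam z <= t by nra.
move: b0 b1; rewrite /below Lt mul1r /= mulr0n add0r => _ _.
have xe x : x \in enum_atoms z -> x <= e * y.
  by move=> xS; exact: le_trans (xL _ xS) Lamy.
have gx x : x \in enum_atoms z -> 1 - c / (y - x) ^+ 2 <= g (t - x).
  move=> /xe xey; have -> : t - x = t - y + (y - x) by ring.
  by apply: Hg; lra.
have e01 : 0 <= e < 1 by rewrite ltW//=; lra.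
have [U1 U2] := onem_prod_le_taylor c0 e01 y0 cy xe gx.
case: large => [->|[-> /extent_leP[NK _ xK]]].
  by rewrite mul1r subrr mulr0 subr0.
rewrite mul0r subr0 -mulrA aE; apply: U2 => //; last by rewrite -aE.
by move=> x xS; have := xK x xS; rewrite ler_norml => /andP[].
Qed.

(** The perturbation [q] is separated from the product by [prod_le_perturb], and
    the atoms beyond [e * s] are dropped from it. *)
Lemma below_le_taylor g z t s e c K q :
  (forall x, 0 <= g x <= 1) -> 0 <= q <= 1 -> 0 <= c -> 0 < e < 1 -> 0 < s ->
  c <= ((1 - e) * s) ^+ 2 -> K <= e * s ->
  (forall y, (1 - e) * s <= y -> g (t - s + y) <= 1 - c / y ^+ 2 + q) ->
  below g t z <=
    1 - \sum_(x <- enum_atoms z) taylor c (3 / (1 + e) ^+ 2) s x +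
    (c / ((1 - e) * s) ^+ 2) ^+ 2 / 2 *
      ((size (enum_atoms z))%:R ^+ 2 - (size (enum_atoms z))%:R) +
    (3 + 2 / e + (e ^+ 2)^-1) * (c / s ^+ 4) *
      ((K < extent z)%R%:R * \sum_(x <- enum_atoms z) x ^+ 2) +
    (1 - \prod_(x <- enum_atoms z) (1 - q)).
Proof.
move=> g01 q01 c0 e01 s0 cs Ks Hg.
have [bb [P1 P2]] := prod_le_taylor (enum_atoms z) c0 e01 s0 cs.
have fx x : g (t - x) <=
    1 - (if x <= e * s then c / (s - x) ^+ 2 else 0) + q.
  case: ifP => xe.
    have -> : t - x = t - s + (s - x) by ring.
    by apply: Hg; lra.
  by have := g01 (t - x); lra.
have below_prod : below g t z <= \prod_(x <- enum_atoms z) g (t - x).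
  rewrite /below; case: (_ <= t); rewrite ?mul1r// mul0r.
  by apply: prodr_ge0 => x _; have /andP[] := g01 (t - x).
apply: le_trans below_prod _.
have gx01 x : x \in enum_atoms z -> 0 <= g (t - x) <= 1 by [].
apply: le_trans (prod_le_perturb q01 gx01 _ (fun x _ => fx x)) _.
  by move=> x _; move: (bb x) => /=; case: ifP => _; lra.
rewrite lerD2r; have [KE|EK] := ltP K (extent z); first by rewrite mul1r.
rewrite mul0r mulr0 addr0; apply: P1 => x xS.
have [_ _ xK] := extent_leP EK.
by rewrite (le_trans (xK x xS)).
Qed.

End Pointwise.

Section Critical.
Context {R : realType} {d0} {W0 : measurableType d0} {P0 : probability W0 R}
  (S0 : {RV P0 >-> scheme R}).
Variables (v h : R).
Hypotheses (v0 : 0 < v) (h0 : 0 < h).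
Hypothesis mean_mass : has_mean P0 (mass S0) 1.
Hypothesis mean_moment1 : has_mean P0 (moment S0 1) 0.
Hypothesis mean_moment2 : has_mean P0 (moment S0 2) h.
Hypothesis mean_mass_sqr : has_mean P0 (fun w => mass S0 w ^+ 2) (v + 1).
Hypothesis atoms_le_Lam : {ae P0, forall w, 0 <= Lam (S0 w) /\
  forall x, x \in enum_atoms (S0 w) -> x <= Lam (S0 w)}.

Let pairs w := mass S0 w ^+ 2 - mass S0 w.

Let mean_pairs : has_mean P0 pairs v.
Proof. by rewrite -[v](addrK 1); exact: has_meanB. Qed.

Let pairs_ge0 w : 0 <= pairs w.
Proof.
rewrite /pairs /mass; case: (size _) => [|n]; first by rewrite expr0n subr0.
by rewrite -natr1; have := ler0n R n; nra.
Qed.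

Let measurable_S0 : measurable_fun setT S0.
Proof. exact: measurable_funPT. Qed.

Let mean_taylor c k y : has_mean P0
  (fun w => \sum_(x <- enum_atoms (S0 w)) taylor c k y x)
  (c / y ^+ 2 + c * k / y ^+ 4 * h).
Proof.
have := has_meanD (has_meanD (has_meanZ (c / y ^+ 2) mean_mass)
  (has_meanZ (2 * c / y ^+ 3) mean_moment1)) (has_meanZ (c * k / y ^+ 4) mean_moment2).
rewrite mulr1 mulr0 addr0; congr (has_mean _ _ _).
by apply/funext => w; rewrite sum_taylor.
Qed.

Let mean_below n t : has_mean P0 (fun w => below (stay S0 n) t (S0 w)) (stay S0 n.+1 t).
Proof.
apply: has_mean_unit_interval.
  exact: (measurableT_comp (measurable_below t (stay_measurable S0 n)) measurable_S0).
by move=> w; apply: below_unit_interval => x; exact: stay_unit_interval.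
Qed.

Let measurable_extent_S0 : measurable_fun setT (extent \o S0).
Proof. exact: (measurableT_comp measurable_extent measurable_S0). Qed.

Lemma stay_antitone n t : stay S0 n.+1 t <= stay S0 n t.
Proof.
elim: n t => [|n IH] t; first by have /andP[] := stay_unit_interval S0 1 t.
apply: (ae_le_mean (mean_below n.+1 t) (mean_below n t)); apply: aeW => w.
rewrite /below; apply: ler_wpM2l; first by rewrite ler0n.
apply: ler_prod => x _; rewrite IH andbT.
by have /andP[] := stay_unit_interval S0 n.+1 (t - x).
Qed.

(** The error [q] is transported by the mean offspring number, which is [1], and
    decreased by a multiple of [q ^+ 2] since the offspring number is not
    deterministic.  The bound [B] is arbitrary, in order to serve both for the
    comparison of two functions [stay] and for a subsolution. *)
Lemma stay_contraction : exists c, 0 < c <= 1 /\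
  forall n t q (B : W0 -> R) b, 0 <= q <= 1 -> has_mean P0 B b ->
    {ae P0, forall w, below (stay S0 n) t (S0 w) <=
       B w + (1 - \prod_(x <- enum_atoms (S0 w)) (1 - q))} ->
    stay S0 n.+1 t <= b + (q - c * q ^+ 2).
Proof.
have v2 : 0 < v / 2 by rewrite divr_gt0.
have [K [m [K1 hm mv]]] := truncated_mean_small measurable_extent_S0 mean_pairs pairs_ge0 v2.
have K0 : 0 < K by lra.
(* At least half of the second factorial moment [v] survives the truncation. *)
pose c := Num.min 1 ((16 * K ^+ 2)^-1 * (v / 2)).
have c0 : 0 < c by rewrite /c lt_min ltr01 mulr_gt0// invr_gt0 mulr_gt0// exprn_gt0.
exists c; split; first by rewrite c0 /c ge_min lexx.
move=> n t q B b q01 hB BW.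
have hq := has_meanB (has_meanZ q mean_mass)
  (has_meanZ (q ^+ 2 / (16 * K ^+ 2)) (has_meanB mean_pairs hm)).
apply: (@le_trans _ _ (b + (q * 1 - q ^+ 2 / (16 * K ^+ 2) * (v - m)))).
  apply: (ae_le_mean (mean_below n t) (has_meanD hB hq)).
  apply: filterS BW => w /le_trans; apply; rewrite lerD2l.
  have [H1 H2] := @onem_prod_const_le R (enum_atoms (S0 w)) K q K1 q01.
  have [KE|EK] := ltP K (extent (S0 w)).
    by rewrite mul1r subrr mulr0 subr0.
  rewrite mul0r subr0; have [NK _ _] := extent_leP EK.
  exact: H2.
rewrite lerD2l mulr1 lerD2l lerN2.
apply: (@le_trans _ _ (((16 * K ^+ 2)^-1 * (v / 2)) * q ^+ 2)).
  by apply: ler_wpM2r; [exact: sqr_ge0|rewrite /c ge_min lexx orbT].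
rewrite (_ : _ / _ * (v - m) = (16 * K ^+ 2)^-1 * (v - m) * q ^+ 2); last by ring.
apply: ler_wpM2r; first exact: sqr_ge0.
apply: ler_wpM2l; last by lra.
by rewrite invr_ge0 mulr_ge0// sqr_ge0.
Qed.

(** Descendants born after generation [N] exist only if the tree
    survives until then. *)
Lemma stay_stabilizes (e : R) : 0 < e ->
  exists N, forall m t, stay S0 N t <= stay S0 (m + N) t + e.
Proof.
move=> e0; have [c [c01 Hc]] := stay_contraction; have /andP[c0 c1] := c01.
have [N qN] := logistic_small c01 e0.
exists N => m t; suff : stay S0 N t <= stay S0 (m + N) t + logistic c N by lra.
have q01 n : 0 <= logistic c n <= 1 by apply: logistic_unit_interval; rewrite c1 ltW.
elim: N t {qN} => [|n IH] t.
  by rewrite addn0 /= lerDr; have /andP[] := stay_unit_interval S0 m t.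
rewrite addnS; apply: (Hc n t _ _ _ (q01 n) (mean_below (m + n) t)).
apply: aeW => w; rewrite /below; case: (Lam (S0 w) <= t); last first.
  rewrite !mul0r add0r subr_ge0.
  have := @prod_unit_interval R _ (enum_atoms (S0 w)) (fun=> 1 - logistic c n).
  case/(_ _)/andP => //.
  by move=> x _; have := q01 n; lra.
rewrite !mul1r; apply: (prod_le_perturb (q01 n)) => x _.
- exact: stay_unit_interval.
- exact: stay_unit_interval.
- exact: IH.
Qed.

(** If [extent <= K], neither the root nor its children come close
    to [t], and the induction hypothesis applies to every subtree. *)
Lemma stay_cvg1 n (e : R) : 0 < e ->
  exists A : R, 0 <= A /\ forall t : R, A <= t -> 1 - stay S0 n t <= e.
Proof.
elim: n e => [|n IH] e e0; first by exists 0; split => // t _ /=; rewrite subrr ltW.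
have e2 : 0 < e / 2 by rewrite divr_gt0.
have [A [A0 HA]] := IH _ e2.
have ge1 (w : W0) : 0 <= cst (1 : R) w by rewrite ler01.
have [K [m [K1 hm me]]] := truncated_mean_small measurable_extent_S0 (has_mean_cst P0 1) ge1 e2.
exists (A + K); split=> [|t At]; first by lra.
have := ae_le_mean (has_meanB (has_mean_cst P0 1) (mean_below n t))
  (has_meanD (has_meanZ (e / 2) mean_mass) hm).
suff H : {ae P0, forall w, cst 1 w - below (stay S0 n) t (S0 w) <=
    e / 2 * mass S0 w + (K < extent (S0 w))%R%:R * cst 1 w} by move=> /(_ H); lra.
apply: aeW => w /=; rewrite mulr1.
have N0 : 0 <= e / 2 * mass S0 w by rewrite mulr_ge0 ?ler0n ?ltW.
have [KE|EK] := ltP K (extent (S0 w)).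
  have /andP[b0 _] := below_unit_interval t (S0 w) (stay_unit_interval S0 n).
  by rewrite /= mulr1n; lra.
have [_ LK xK] := extent_leP EK.
rewrite addr0 /below (_ : _ <= t); last by lra.
rewrite mul1r.
have u01 x : x \in enum_atoms (S0 w) -> 0 <= 1 - stay S0 n (t - x) <= 1.
  by move=> _; have /andP[? ?] := stay_unit_interval S0 n (t - x); lra.
have := prod_onem_ge u01.
under eq_bigr do rewrite subKr.
suff : \sum_(x <- enum_atoms (S0 w)) (1 - stay S0 n (t - x)) <= e / 2 * mass S0 w by lra.
rewrite /mass -sum1_size natr_sum mulr_sumr big_seq [leRHS]big_seq.
apply: ler_sum => x xS; rewrite mulr1; apply: HA.
by have := xK x xS; have := ler_norm x; lra.
Qed.

(** Finitely many generations suffice up to [e / 2], uniformly in the level. *)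
Lemma stay_uniform_cvg1 (e : R) : 0 < e ->
  exists A : R, 0 <= A /\ forall n (t : R), A <= t -> 1 - stay S0 n t <= e.
Proof.
move=> e0; have e2 : 0 < e / 2 by rewrite divr_gt0.
have [N HN] := stay_stabilizes e2; have [A [A0 HA]] := stay_cvg1 N e2.
exists A; split=> // n t At; have := HA t At; have := HN n t.
suff : stay S0 (n + N) t <= stay S0 n t by lra.
elim: N {HN HA} => [|N IH]; first by rewrite addn0.
by rewrite addnS (le_trans (stay_antitone _ _)).
Qed.

(** Induction on [n] with the supersolution [c / y ^+ 2], [y = t - A + L].  The
    claim is also needed for [y] slightly below [L], between [(1 - e) * L] and
    [L], because a jump of size up to [e * y] may lead there; in this zone it
    follows from [stay_uniform_cvg1] by the choice of [A]. *)
Lemma stay_upper_bound (c : R) :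
  (forall e, 0 < e -> exists r0, forall r, r0 <= r ->
     fine (P0 [set w | r < Lam (S0 w)]) <= e / r ^+ 4) ->
  6 * h < c * v -> exists A L, [/\ 0 < L, L <= A & forall n t, A <= t ->
    1 - stay S0 n t <= c / (t - A + L) ^+ 2].
Proof.
move=> tail hcv.
have cv0 : 0 < c * v by apply: lt_trans hcv; rewrite mulr_gt0.
have c0 : 0 < c by rewrite pmulr_lgt0 in cv0.
have [e [/andP[e0 e1] ev He]] := exists_eps_upper c0 (ltW h0) v0 hcv.
have [K [m [K1 hm me]]] := truncated_mean_small measurable_extent_S0 mean_pairs pairs_ge0 e0.
have [r0 Hr0] := tail (e * e ^+ 4) (mulr_gt0 e0 (exprn_gt0 4 e0)).
(* For [y >= L] the atoms of size at most [K] lie in the range of the expansion,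
   the tail estimate of [Lam] holds at [e * y], the values [c / (y - x) ^+ 2] with
   [x <= e * y] are at most [1], and the fraction lost in [onem_below_le] is at
   most [e]. *)
pose L := Num.max 1 (Num.max (K / e) (Num.max (r0 / e) (Num.max (4 * c) (K * c / e)))).
have := lexx L; rewrite {1}/L !ge_max !ler_pdivrMr// => /and5P[L1 LK Lr Lc LKc].
have L0 : 0 < L by lra.
have [A1 [A10 HA1]] := stay_uniform_cvg1 (divr_gt0 c0 (exprn_gt0 2 L0)).
pose A := A1 + L + L * e.
have eL : 0 < L * e by rewrite mulr_gt0.
exists A, L; split=> //; first by rewrite /A; lra.
suff H n t : (1 - e) * L <= t - A + L -> 1 - stay S0 n t <= c / (t - A + L) ^+ 2.
  by move=> n t At; apply: H; lra.
elim: n t => [|n IH] t ty; first by rewrite subrr divr_ge0 ?sqr_ge0// ltW.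
have [tA|At] := ltP t A.
  apply: le_trans (HA1 n.+1 t _) _; first by rewrite /A in ty *; lra.
  have s0 : 0 < t - A + L by apply: lt_le_trans ty; rewrite mulr_gt0//; lra.
  apply: ler_wpM2l; first exact: ltW.
  rewrite lef_pV2 ?posrE ?exprn_gt0// lerXn2r ?nnegrE ?ltW//.
  by lra.
have [y yE] : exists y, y = t - A + L by eexists.
rewrite -yE in ty *.
have yL : L <= y by lra.
have yt : y <= t by rewrite yE /A; lra.
have eLy : L * e <= e * y by rewrite mulrC ler_pM2l.
have Kc : 0 <= K * c <= e * y ^+ 2.
  apply/andP; split; first by rewrite mulr_ge0// ltW//; lra.
  apply: (le_trans LKc); apply: (le_trans eLy).
  by rewrite ler_pM2l// expr2 ler_peMl//; lra.
have e12 : 0 < e <= 1 / 2 by rewrite e0.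
have y0 : 0 < y by lra.
have [Ka gain] := upper_gain c0 e12 ev me y0 Kc He.
set a := c / _ in Ka gain.
have mG := has_meanZ ((1 - K * a) * (a ^+ 2 / 2)) (has_meanB mean_pairs hm).
have tailE : fine (P0 [set w | e * y < Lam (S0 w)]) <= e / y ^+ 4.
  have := Hr0 (e * y) (le_trans Lr eLy).
  by rewrite exprMn invfM mulrA mulfK ?gt_eqF ?exprn_gt0.
apply: le_trans (ae_le_mean (has_meanB (has_mean_cst P0 1) (mean_below n t))
  (has_meanB (has_meanD (has_mean_Lam_gt S0 (e * y))
    (mean_taylor c (3 / (1 - e) ^+ 2) y)) mG) _) _; last by lra.
apply: filterS atoms_le_Lam => w [_ xL].
apply: (onem_below_le (a := a)) => //.
- exact: stay_unit_interval.
- exact: ltW.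
- by rewrite y0.
- by apply: le_sqr_onem; [rewrite ltW|lra|lra].
- exact: le_trans LK eLy.
- by lra.
- move=> s sy; have := IH (t - y + s); rewrite yE.
  have -> : t - (t - A + L) + s - A + L = s by ring.
  suff H : (1 - e) * L <= s by move=> /(_ H); rewrite -yE; lra.
  by apply: le_trans sy; apply: ler_wpM2l => //; lra.
Qed.

(** Induction on [n] with the subsolution [c / s ^+ 2], [s = t + L], up to the
    vanishing error [logistic b n].  For negative [t] nothing has to be
    compared, as the root already exceeds [t]. *)
Lemma stay_lower_bound (c : R) : 0 < c -> c * v < 6 * h ->
  exists2 L : R, 0 < L & forall e t : R, 0 < e -> 0 <= t ->
    exists n, c / (t + L) ^+ 2 <= 1 - stay S0 n t + e.
Proof.
move=> c0 hcv.
have [e [p [/andP[e0 e1] p0 He]]] := exists_eps_lower c0 (ltW h0) v0 hcv.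
have moment2_ge0 w : 0 <= moment S0 2 w by apply: sumr_ge0 => x _; exact: sqr_ge0.
have [K [m [K1 hm mp]]] := truncated_mean_small measurable_extent_S0 mean_moment2 moment2_ge0 p0.
have [b [b01 Hb]] := stay_contraction; have /andP[b0 b1] := b01.
pose L := Num.max 1 (Num.max (K / e) (8 * c)).
have := lexx L; rewrite {1}/L !ge_max !ler_pdivrMr// => /and3P[L1 LK Lc].
have q01 n : 0 <= logistic b n <= 1 by apply: logistic_unit_interval; rewrite b1 ltW.
have eL0 : 0 < (1 - e) * L by rewrite mulr_gt0//; lra.
suff H n t : (1 - e) * L <= t + L ->
    stay S0 n t <= 1 - c / (t + L) ^+ 2 + logistic b n.
  exists L; first by lra.
  move=> q t qpos tpos; have [n nq] := logistic_small b01 qpos.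
  have tL : (1 - e) * L <= t + L by nra.
  by exists n; have := H n t tL; lra.
have w01 y : (1 - e) * L <= y -> 0 <= c / y ^+ 2 <= 1.
  move=> yL; have y0 : 0 < y by apply: lt_le_trans yL.
  apply/andP; split; first by rewrite divr_ge0 ?sqr_ge0// ltW.
  rewrite ler_pdivrMr ?exprn_gt0// mul1r.
  apply: le_trans (le_sqr_onem (e := e) (y := L) _ _ _) _; [by lra..|].
  by apply: lerXn2r; rewrite ?nnegrE// ltW.
elim: n t => [|n IH] t ts; first by rewrite /=; have := w01 _ ts; lra.
have [t0|t0] := ltP t 0.
  have -> : stay S0 n.+1 t = 0.
    apply: le_anti; have /andP[-> _] := stay_unit_interval S0 n.+1 t; rewrite andbT.
    apply: (ae_le_mean (mean_below n t) (has_mean_cst P0 0)).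
    apply: filterS atoms_le_Lam => w [L0 _].
    have nL : (Lam (S0 w) <= t) = false by rewrite leNgt (lt_le_trans t0 L0).
    by rewrite /below nL mul0r.
  by have := w01 _ ts; have := q01 n.+1; lra.
have [s sE] : exists s, s = t + L by eexists.
rewrite -sE in ts *.
have sL : L <= s by lra.
have s0 : 0 < s by lra.
have eLs : L * e <= e * s by rewrite mulrC ler_pM2l.
have e12 : 0 < e <= 1 / 2 by rewrite e0.
have gain := lower_gain c0 e12 mp s0 He.
have mB := has_meanD (has_meanD (has_meanB (has_mean_cst P0 1)
  (mean_taylor c (3 / (1 + e) ^+ 2) s))
  (has_meanZ ((c / ((1 - e) * s) ^+ 2) ^+ 2 / 2) mean_pairs))
  (has_meanZ ((3 + 2 / e + (e ^+ 2)^-1) * (c / s ^+ 4)) hm).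
apply: le_trans (Hb n t (logistic b n) _ _ (q01 n) mB _) _; last first.
  by rewrite -/(logistic b n.+1) lerD2r; lra.
apply: aeW => w; apply: below_le_taylor => //.
- exact: stay_unit_interval.
- exact: ltW.
- by rewrite e0; lra.
- by apply: le_sqr_onem; [rewrite ltW|lra|lra].
- exact: le_trans LK eLs.
- move=> y ys; have -> : t - s + y = y - L by rewrite sE; ring.
  have := IH (y - L); rewrite subrK; apply.
  by apply: le_trans ys; apply: ler_wpM2l => //; lra.
Qed.

End Critical.

(** * Asymptotics of the tail *)

Theorem theorem1 (R : realType) (sigma eta : R)
  (d0 : measure_display) (W0 : measurableType d0) (P0 : probability W0 R)
  (S0 : {RV P0 >-> scheme R})
  (d : measure_display) (W : measurableType d) (P : probability W R)
  (S : word -> {RV P >-> scheme R})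
  (scheme_S0 : reproduction_scheme S0)
  (copies_S : iid_copies S0 S)
  (mean_mass : (\int[P0]_w chi (S0 w) [set: R] = 1)%E)
  (centered : (\int[P0]_w \int[chi (S0 w)]_x x%:E = 0)%E)
  (second_mass : (\int[P0]_w (chi (S0 w) [set: R] ^+ 2) = (sigma ^+ 2 + 1)%:E)%E)
  (sigma_gt0 : 1 < sigma ^+ 2 + 1)
  (second_moment : (\int[P0]_w \int[chi (S0 w)]_x (x ^+ 2)%:E = (eta ^+ 2)%:E)%E)
  (eta_gt0 : 0 < eta ^+ 2)
  (tail_Lam : (fun r : R => fine (P0 [set w | r < Lam (S0 w)]))
     =o_ (pinfty_nbhs R) (fun r : R => r ^- 4))
  (mean_dec : ('E_P0[dec \o S0] = 1)%E) :
  (fun r : R => fine (P [set w | (r%:E < sup_Lam (fun u => S u w))%E]))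
    ~_ (pinfty_nbhs R)
  (fun r : R => 6 * eta ^+ 2 / (sigma ^+ 2 * r ^+ 2)).
Proof.
have v0 : 0 < sigma ^+ 2 by lra.
have hN := has_mean_mass mean_mass.
have hN2 := has_mean_mass_sqr second_mass.
have hX2 := has_mean_moment2 second_moment.
have hX1 := has_mean_moment1 hN.1 hX2.1 centered.
have aeL := ae_atoms_le_Lam scheme_S0.
have tail e : 0 < e -> exists r0, forall r, r0 <= r ->
    fine (P0 [set w | r < Lam (S0 w)]) <= e / r ^+ 4.
  move=> e0; have /eqoP/(_ e e0)[M [_ HM]] := tail_Lam.
  exists (Num.max (M + 1) 1) => r; rewrite ge_max => /andP[rM r1].
  have := HM r; rewrite /= => /(_ _)/(le_trans (ler_norm _)).
  rewrite ger0_norm ?invr_ge0 ?exprn_ge0//; last by lra.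
  by apply; lra.
set u := fun r : R => fine (P [set w | _]).
pose C := 6 * eta ^+ 2 / sigma ^+ 2.
have C0 : 0 < C by rewrite divr_gt0// mulr_gt0.
have CE r : 6 * eta ^+ 2 / (sigma ^+ 2 * r ^+ 2) = C / r ^+ 2.
  by rewrite /C invfM mulrA.
have upper c : C < c -> exists A L, [/\ 0 < L, L <= A &
    forall t, A <= t -> u t <= c / (t - A + L) ^+ 2].
  rewrite ltr_pdivrMr// => Cc.
  have [A [L [L0 LA H]]] := stay_upper_bound v0 eta_gt0 hN hX1 hX2 hN2 aeL tail Cc.
  exists A, L; split => // t At; apply: (tail_le_stay copies_S) => n; exact: H.
have lower c : 0 < c -> c < C -> exists2 L : R, 0 < L &
    forall t, 0 <= t -> c / (t + L) ^+ 2 <= u t.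
  rewrite ltr_pdivlMr// => c0 cC.
  have [L L0 H] := stay_lower_bound v0 eta_gt0 hN hX1 hX2 hN2 aeL c0 cC.
  exists L => // t t0; apply/ler_addgt0Pr => e e0.
  have [n Hn] := H e t e0 t0; apply: le_trans Hn _.
  by rewrite lerD2r; exact: tail_ge_stay.
apply/eqaddoP => eps eps0.
(* The lower bound is stated for relative errors smaller than [1]. *)
pose e := Num.min eps (1 / 2).
have e0 : 0 < e by rewrite /e lt_min eps0/=; lra.
have e1 : e < 1 by rewrite /e gt_min; apply/orP; right; lra.
have ee : e <= eps by rewrite /e ge_min lexx.
have [r1 H1] := inverse_square_upper C0 e0 upper.
have e01 : 0 < e < 1 by rewrite e0.
have [r2 H2] := inverse_square_lower C0 e01 lower.
exists (Num.max r1 r2); split; first exact: num_real.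
move=> r; rewrite gt_max => /andP[/ltW r1r /ltW r2r].
have {}H1 := H1 r r1r; have {}H2 := H2 r r2r.
have Cr : 0 <= C / r ^+ 2 by rewrite divr_ge0 ?sqr_ge0// ltW.
have eC : e * (C / r ^+ 2) <= eps * (C / r ^+ 2) by rewrite ler_wpM2r.
suff : `|u r - C / r ^+ 2| <= eps * `|C / r ^+ 2| by rewrite -CE.
rewrite [in leRHS]ger0_norm// (le_trans _ eC)// ler_norml.
by apply/andP; split; lra.
Qed.
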